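(* For $(\gamma_1,\delta_1),(\gamma_2,\delta_2)\in\mathbb T^2\cup\{(0,0)\}$ and $s_1,s_2\in\{\to,\leftarrow\}$ let $\mathsf F_{s_1s_2}(\gamma_1,\delta_1;\gamma_2,\delta_2)$ denote the two-faced universal product of states associated with lifts to the free product, where face $i$ is equipped with the universal lift $(\overrightarrow{\lambda}^{\gamma_i},\overrightarrow{\rho}^{\delta_i})$ if $s_i={\to}$ and with $(\overleftarrow{\lambda}^{\gamma_i},\overleftarrow{\rho}^{\delta_i})$ if $s_i={\leftarrow}$. Every element of the set $$\bigl\{\mathsf F_{s_1s_2}(\gamma_1,\delta_1;\gamma_2,\delta_2):\ s_1,s_2\in\{\to,\leftarrow\},\ (\gamma_1,\delta_1),(\gamma_2,\delta_2)\in\mathbb T^2\cup\{(0,0)\}\bigr\}$$ coincides with exactly one of the following list: (1) $\mathsf F_{\to\to}(\zeta,\theta;1,1)=\mathsf F_{\leftarrow\leftarrow}(\zeta,\theta;1,1)$ with $\zeta,\theta\in\mathbb T$; (2) $\mathsf F_{\to\leftarrow}(\zeta,\theta;1,1)=\mathsf F_{\leftarrow\to}(\zeta,\theta;1,1)$ with $\zeta,\theta\in\mathbb T$; (3) $\mathsf F_{\to\to}(1,1;0,0)=\mathsf F_{\to\leftarrow}(1,1;0,0)=\mathsf F_{\leftarrow\to}(1,1;0,0)=\mathsf F_{\leftarrow\leftarrow}(1,1;0,0)$; (4) $\mathsf F_{\to\to}(0,0;1,1)=\mathsf F_{\to\leftarrow}(0,0;1,1)=\mathsf F_{\leftarrow\to}(0,0;1,1)=\mathsf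 F_{\leftarrow\leftarrow}(0,0;1,1)$; (5) $\mathsf F_{\to\to}(0,0;0,0)$.
   Context: $\mathbb T=\{z\in\mathbb C:|z|=1\}$. Pre-Hilbert spaces. All pre-Hilbert spaces are complex, with inner product linear in the second argument, and equipped with a distinguished unit vector, always denoted $\Omega$; $\hat H=H\ominus\mathbb C\Omega$. $L_{\mathrm a}(H)$ is the $\ast$-algebra of adjointable linear operators on $H$. $P_\Omega$ is the orthogonal projection onto $\mathbb C\Omega$, $P_{\Omega^\perp}=\mathrm{id}-P_\Omega$. Free product. $H_1\ast H_2=\mathbb C\Omega\oplus\bigoplus_{n\ge1}\bigoplus_{\mathbf k}\hat H_{k_1}\otimes\cdots\otimes\hat H_{k_n}$ (algebraic), $\mathbf k$ running over the alternating tuples in $\{1,2\}^n$ ($k_i\ne k_{i+1}$). The map $T\mapsto T_\gamma$. With respect to $H=\mathbb C\Omega\oplus\hat H$ write $T=\begin{pmatrix}\tau&(t')^*\\ t&\hat T\end{pmatrix}$ with $\tau\in\mathbb C$, $t,t'\in\hat H$, $\hat T\in L_{\mathrm a}(\hat H)$, where $(t')^*$ denotes $h\mapsto\langle t',h\rangle$. Then $T_\gamma:=\begin{pmatrix}|\gamma|\tau&(\gamma t')^*\\ \gamma t&|\gamma|\hat T\end{pmatrix}$. The lifts. For $\ell\in\{1,2\}$ let $H(\ell)\subset H_1\ast H_2$ be the direct sum of $\mathbb C\Omega$ and all $\hat H_{k_1}\otimes\cdots\otimes\hat H_{k_n}$ with $\mathbf k$ alternating and $k_1\ne\ell$. Let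 $U\colon H_1\ast H_2\to H_1\otimes H(1)$ be the unitary with $\Omega\mapsto\Omega\otimes\Omega$, $x\mapsto x\otimes\Omega$, $x\otimes w\mapsto x\otimes w$, $w\mapsto\Omega\otimes w$ for $x\in\hat H_1$ and $w$ an alternating tensor starting in $\hat H_2$; let $V\colon H_1\ast H_2\to H_2\otimes H(2)$ be the analogous unitary with the roles of $1,2$ exchanged. Let $R$ be the unitary on $H_1\ast H_2$ with $R(x_1\otimes\cdots\otimes x_n)=x_n\otimes\cdots\otimes x_1$, $R\Omega=\Omega$. For $T\in L_{\mathrm a}(H_1)$, $S\in L_{\mathrm a}(H_2)$: $\overrightarrow{\lambda}^\gamma_{H_1,H_2}(T)=U^*(T\otimes P_\Omega+T_\gamma\otimes P_{\Omega^\perp})U$, $\overrightarrow{\rho}^\delta_{H_1,H_2}(S)=V^*(S\otimes P_\Omega+S_\delta\otimes P_{\Omega^\perp})V$, $\overleftarrow{\lambda}^\gamma_{H_1,H_2}(T)=R^*\,\overrightarrow{\lambda}^\gamma_{H_1,H_2}(T)R$, $\overleftarrow{\rho}^\delta_{H_1,H_2}(S)=R^*\,\overrightarrow{\rho}^\delta_{H_1,H_2}(S)R$. These are $\ast$-homomorphisms into $L_{\mathrm a}(H_1\ast H_2)$ for $\gamma,\delta\in\mathbb T\cup\{0\}$. $\ast$-algebras and states. $\ast$-algebras are over $\mathbb C$ and not assumed unital; $\sqcup$ is the non-unital free product (coproduct) of $\ast$-algebras. A linear functional is a state if its unital extension to the unitization is positive. A two-faced $\ast$-algebra is a $\ast$-algebra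 $A$ with $\ast$-subalgebras $A^{(1)},A^{(2)}$ such that $A=A^{(1)}\sqcup A^{(2)}$ canonically. Associated product of states. Let the universal lift of face $i$ be $(\lambda^{(i)},\rho^{(i)})$, $i=1,2$. Let $\phi,\psi$ be states on two-faced $\ast$-algebras $A,B$. Choose $\ast$-representations $\pi\colon A\to L_{\mathrm a}(H)$, $\sigma\colon B\to L_{\mathrm a}(G)$ with $\phi=\langle\Omega,\pi(\cdot)\Omega\rangle$, $\psi=\langle\Omega,\sigma(\cdot)\Omega\rangle$. Let $\Pi\colon A\sqcup B\to L_{\mathrm a}(H\ast G)$ be the $\ast$-homomorphism with $\Pi(a)=\lambda^{(i)}_{H,G}(\pi(a))$ for $a\in A^{(i)}$ and $\Pi(b)=\rho^{(i)}_{H,G}(\sigma(b))$ for $b\in B^{(i)}$, $i=1,2$. The product of $\phi$ and $\psi$ is the state $c\mapsto\langle\Omega,\Pi(c)\Omega\rangle$ on $A\sqcup B$; it does not depend on the choice of $\pi,\sigma$. Two such products coincide if they give the same state for all choices of $A,B,\phi,\psi$. *)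

(* Defs.v *)
From HB Require Import structures.
From mathcomp Require Import all_boot all_order all_algebra.
From mathcomp Require Import ring.
From mathcomp Require Import boolp classical_sets functions.

Set Implicit Arguments.
Unset Strict Implicit.
Unset Printing Implicit Defensive.

Import Order.TTheory GRing.Theory Num.Theory.
Local Open Scope ring_scope.

(** * Pre-Hilbert spaces with a distinguished unit vector *)

HB.mixin Record isPreHilbert (C : numClosedFieldType) H of GRing.Lmodule C H := {
  inner : H -> H -> C;
  inner_linear : forall (x : H) (a : C) (y z : H),
    inner x (a *: y + z) = a * inner x y + inner x z;
  inner_conj : forall x y : H, inner y x = (inner x y)^*;
  inner_ge0 : forall x : H, 0 <= inner x x;
  inner_eq0 : forall x : H, inner x x = 0 -> x = 0;
  vac : H;
  inner_vac : inner vac vac = 1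
}.

#[short(type="preHilbertType")]
HB.structure Definition PreHilbert (C : numClosedFieldType) :=
  {H of isPreHilbert C H & GRing.Lmodule C H}.

Notation "⟨ x , y ⟩" := (inner x y)
  (at level 0, x, y at level 99, format "⟨ x ,  y ⟩") : ring_scope.
Notation Ω := vac.

Section InnerTheory.
Variables (C : numClosedFieldType) (H : preHilbertType C).
Implicit Types (x y z : H) (a : C).

Lemma innerDr x y z : ⟨x, y + z⟩ = ⟨x, y⟩ + ⟨x, z⟩.
Proof. by have := inner_linear x 1 y z; rewrite scale1r mul1r. Qed.

Lemma inner0r x : ⟨x, 0⟩ = 0.
Proof. by apply: (addrI ⟨x, 0⟩); rewrite -innerDr !addr0. Qed.

Lemma innerZr a x y : ⟨x, a *: y⟩ = a * ⟨x, y⟩.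
Proof. by have := inner_linear x a y 0; rewrite inner0r !addr0. Qed.

Lemma innerNr x y : ⟨x, - y⟩ = - ⟨x, y⟩.
Proof. by rewrite -scaleN1r innerZr mulN1r. Qed.

Lemma innerBr x y z : ⟨x, y - z⟩ = ⟨x, y⟩ - ⟨x, z⟩.
Proof. by rewrite innerDr innerNr. Qed.

Lemma innerDl x y z : ⟨x + y, z⟩ = ⟨x, z⟩ + ⟨y, z⟩.
Proof. by rewrite inner_conj innerDr rmorphD /= -!inner_conj. Qed.

Lemma innerZl a x y : ⟨a *: x, y⟩ = a^* * ⟨x, y⟩.
Proof. by rewrite inner_conj innerZr rmorphM /= -inner_conj. Qed.

Lemma inner0l x : ⟨0, x⟩ = 0.
Proof. by rewrite inner_conj inner0r rmorph0. Qed.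

Lemma innerNl x y : ⟨- x, y⟩ = - ⟨x, y⟩.
Proof. by rewrite inner_conj innerNr rmorphN /= -inner_conj. Qed.

Lemma innerBl x y z : ⟨x - y, z⟩ = ⟨x, z⟩ - ⟨y, z⟩.
Proof. by rewrite innerDl innerNl. Qed.

Lemma inner_sumr I (r : seq I) (F : I -> H) x :
  ⟨x, \sum_(i <- r) F i⟩ = \sum_(i <- r) ⟨x, F i⟩.
Proof.
by elim: r => [|i r IH]; rewrite ?big_nil ?inner0r // !big_cons innerDr IH.
Qed.

Lemma inner_suml I (r : seq I) (F : I -> H) x :
  ⟨\sum_(i <- r) F i, x⟩ = \sum_(i <- r) ⟨F i, x⟩.
Proof.
by elim: r => [|i r IH]; rewrite ?big_nil ?inner0l // !big_cons innerDl IH.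
Qed.

Lemma inner_inj x y : (forall z, ⟨z, x⟩ = ⟨z, y⟩) -> x = y.
Proof.
move=> e; apply/eqP; rewrite -subr_eq0; apply/eqP/inner_eq0.
by rewrite innerBr e subrr.
Qed.

Lemma inner_injl x y : (forall z, ⟨x, z⟩ = ⟨y, z⟩) -> x = y.
Proof. by move=> e; apply: inner_inj => z; rewrite inner_conj e -inner_conj. Qed.

End InnerTheory.

(** * Adjointable operators *)

Section Adjointable.
Variables (C : numClosedFieldType) (H K : preHilbertType C).

(* No linearity clause: a map with an adjoint is linear, see [Ladj_linear]. *)
Definition adjointable : {pred H -> K} := fun f =>
  `[< exists g : K -> H, forall x y, ⟨g x, y⟩ = ⟨x, f y⟩ >].

Fact adjointable_closed : subsemimod_closed adjointable.
Proof.
split; first split.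
- by apply/asboolP; exists (fun=> 0) => x y; rewrite inner0l inner0r.
- move=> f g /asboolP[f' f'P] /asboolP[g' g'P]; apply/asboolP.
  by exists (fun x => f' x + g' x) => x y; rewrite innerDl innerDr f'P g'P.
- move=> a f /asboolP[f' f'P]; apply/asboolP.
  exists (fun x => a^* *: f' x) => x y.
  by rewrite innerZl innerZr conjCK f'P.
Qed.
HB.instance Definition _ := GRing.isSubmodClosed.Build C (H -> K) adjointable
  adjointable_closed.

Record Ladj := MkLadj { Lfun :> H -> K; _ : Lfun \in adjointable }.

HB.instance Definition _ := [isSub for Lfun].
HB.instance Definition _ := [Choice of Ladj by <:].
HB.instance Definition _ := [SubChoice_isSubLmodule of Ladj by <:].

End Adjointable.

(** * Star-algebras *)

HB.mixin Record isStarAlg (C : numClosedFieldType) A of GRing.Lmodule C A := {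
  smul : A -> A -> A;
  star : A -> A;
  smulA : associative smul;
  smulDl : left_distributive smul +%R;
  smulDr : right_distributive smul +%R;
  smulZl : forall (c : C) (a b : A), smul (c *: a) b = c *: smul a b;
  smulZr : forall (c : C) (a b : A), smul a (c *: b) = c *: smul a b;
  starD : {morph star : a b / a + b};
  starZ : forall (c : C) (a : A), star (c *: a) = c^* *: star a;
  starM : forall a b : A, star (smul a b) = smul (star b) (star a);
  starK : involutive star
}.

#[short(type="starAlgType")]
HB.structure Definition StarAlg (C : numClosedFieldType) :=
  {A of isStarAlg C A & GRing.Lmodule C A}.

Notation "a ⋅ b" := (smul a b) (at level 40, left associativity) : ring_scope.

Definition star_hom (C : numClosedFieldType) (A B : starAlgType C)
    (f : A -> B) : Prop :=
  [/\ linear f, {morph f : a b / a ⋅ b} & {morph f : a / star a}].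

Section AdjointTheory.
Variable C : numClosedFieldType.
Implicit Types H K M : preHilbertType C.

Lemma LfunP H K (T : Ladj H K) :
  exists g : K -> H, forall x y, ⟨g x, y⟩ = ⟨x, T y⟩.
Proof. by case: T => f /= /asboolP. Qed.

Lemma Ladj_ext H K (S T : Ladj H K) : S =1 T -> S = T.
Proof. by move=> e; apply: val_inj; apply/funext. Qed.

Definition mkL H K (f : H -> K) (g : K -> H)
    (fg : forall x y, ⟨g x, y⟩ = ⟨x, f y⟩) : Ladj H K :=
  MkLadj (introT (asboolP _) (ex_intro _ g fg)).

Lemma dag_subproof H K (T : Ladj H K) (g := projT1 (cid (LfunP T))) :
  forall x y, ⟨T x, y⟩ = ⟨x, g y⟩.
Proof.
by move=> x y; rewrite /g; case: cid => g' /= g'P; rewrite inner_conj -g'P -inner_conj.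
Qed.

Definition dag H K (T : Ladj H K) : Ladj K H := mkL (dag_subproof T).

Lemma dagP H K (T : Ladj H K) x y : ⟨dag T x, y⟩ = ⟨x, T y⟩.
Proof. by rewrite inner_conj -dag_subproof -inner_conj. Qed.

Lemma dagPr H K (T : Ladj H K) x y : ⟨x, dag T y⟩ = ⟨T x, y⟩.
Proof. by rewrite inner_conj dagP -inner_conj. Qed.

Lemma dag_uniq H K (T : Ladj H K) (g : K -> H) :
  (forall x y, ⟨g x, y⟩ = ⟨x, T y⟩) -> dag T =1 g.
Proof. by move=> gP x; apply: inner_injl => z; rewrite dagP gP. Qed.

Lemma Ladj_linear H K (T : Ladj H K) : linear T.
Proof.
by move=> a x y; apply: inner_inj => z; rewrite innerDr innerZr -!dagP innerDr innerZr.
Qed.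
HB.instance Definition _ H K (T : Ladj H K) := GRing.isLinear.Build C H K _ (Lfun T)
  (Ladj_linear T).

Lemma LcompP H K M (S : Ladj K M) (T : Ladj H K) x y :
  ⟨dag T (dag S x), y⟩ = ⟨x, S (T y)⟩.
Proof. by rewrite !dagP. Qed.

Definition Lcomp H K M (S : Ladj K M) (T : Ladj H K) : Ladj H M :=
  @mkL H M (fun x => S (T x)) (fun x => dag T (dag S x)) (LcompP S T).

Definition Lid H : Ladj H H := @mkL H H id id (fun _ _ => erefl).

Lemma LaddE H K (S T : Ladj H K) x : (S + T) x = S x + T x. Proof. by []. Qed.
Lemma LscaleE H K (c : C) (S : Ladj H K) x : (c *: S) x = c *: S x.
Proof. by []. Qed.

End AdjointTheory.

Notation "S ∘ T" := (Lcomp S T) (at level 40, left associativity) : ring_scope.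
Notation "T ^†" := (dag T) (at level 1, format "T ^†") : ring_scope.
Notation "''L' ( H )" := (Ladj H%type H%type) (at level 0, format "''L' ( H )") : type_scope.

Section AdjointableAlgebra.
Variables (C : numClosedFieldType) (H : preHilbertType C).
Implicit Types S T V : 'L(H).

Fact LcompA : associative (fun S T => S ∘ T). Proof. by move=> S T V; apply: Ladj_ext. Qed.
Fact LcompDl : left_distributive (fun S T => S ∘ T) +%R.
Proof. by move=> S T V; apply: Ladj_ext. Qed.
Fact LcompDr : right_distributive (fun S T => S ∘ T) +%R.
Proof.
move=> S T V; apply: Ladj_ext => x /=.
by have := Ladj_linear S 1 (T x) (V x); rewrite !scale1r.
Qed.
Fact LcompZl (c : C) S T : (c *: S) ∘ T = c *: (S ∘ T).
Proof. exact: Ladj_ext. Qed.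
Fact LcompZr (c : C) S T : S ∘ (c *: T) = c *: (S ∘ T).
Proof.
apply: Ladj_ext => x; apply: inner_inj => z.
by rewrite LscaleE innerZr /= -!dagP innerZr -(dagP T).
Qed.
Fact dagD : {morph (fun T : 'L(H) => T^†) : S T / S + T}.
Proof.
by move=> S T; apply: Ladj_ext; apply: dag_uniq => x y; rewrite innerDl !dagP innerDr.
Qed.
Fact dagZ (c : C) T : (c *: T)^† = c^* *: T^†.
Proof.
by apply: Ladj_ext; apply: dag_uniq => x y; rewrite innerZl conjCK !dagP innerZr.
Qed.
Fact dagM S T : (S ∘ T)^† = T^† ∘ S^†.
Proof. by apply: Ladj_ext; apply: dag_uniq => x y; rewrite !dagP. Qed.
Fact dagK : involutive (fun T : 'L(H) => T^†).
Proof. by move=> T; apply: Ladj_ext; apply: dag_uniq => x y; rewrite dagPr. Qed.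

HB.instance Definition _ := isStarAlg.Build C 'L(H)
  LcompA LcompDl LcompDr LcompZl LcompZr dagD dagZ dagM dagK.

End AdjointableAlgebra.

(** * States and free products of star-algebras *)

Section Unitization.
Variables (C : numClosedFieldType) (A : starAlgType C).

Definition unitization := (C^o * A)%type.
HB.instance Definition _ := GRing.Lmodule.on unitization.
Implicit Types x y z : unitization.

Definition unitz_mul x y : unitization :=
  (x.1 * y.1, x.1 *: y.2 + y.1 *: x.2 + x.2 ⋅ y.2).
Definition unitz_star x : unitization := (x.1^*, star x.2).

Fact unitz_mulA : associative unitz_mul.
Proof.
move=> [a x] [b y] [c z]; rewrite /unitz_mul /=; congr pair; first exact: mulrA.
rewrite !scalerDr !smulDl !smulDr !scalerA !smulZl !smulZr smulA !addrA.
by rewrite (mulrC c a) (mulrC c b) [LHS](ACl (1*2*4*6*3*5*7)).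
Qed.
Fact unitz_mulDl : left_distributive unitz_mul +%R.
Proof.
move=> [a x] [b y] [c z]; rewrite /unitz_mul /=; congr pair; first exact: mulrDl.
by rewrite /= scalerDl scalerDr smulDl [RHS]addrACA [X in _ = X + _]addrACA.
Qed.
Fact unitz_mulDr : right_distributive unitz_mul +%R.
Proof.
move=> [a x] [b y] [c z]; rewrite /unitz_mul /=; congr pair; first exact: mulrDr.
by rewrite /= scalerDl scalerDr smulDr [RHS]addrACA [X in _ = X + _]addrACA.
Qed.
Fact unitz_mulZl (c : C) x y : unitz_mul (c *: x) y = c *: unitz_mul x y.
Proof.
case: x y => [a x] [b y]; rewrite /unitz_mul /=; congr pair.
  by rewrite /= /GRing.scale /= mulrA.
by rewrite /= !scalerDr smulZl !scalerA (mulrC b).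
Qed.
Fact unitz_mulZr (c : C) x y : unitz_mul x (c *: y) = c *: unitz_mul x y.
Proof.
case: x y => [a x] [b y]; rewrite /unitz_mul /=; congr pair.
  by rewrite /= /GRing.scale /= mulrCA.
by rewrite /= !scalerDr smulZr !scalerA (mulrC a).
Qed.
Fact unitz_starD : {morph unitz_star : x y / x + y}.
Proof. by move=> [a x] [b y]; congr pair; rewrite /= ?rmorphD ?starD. Qed.
Fact unitz_starZ (c : C) x : unitz_star (c *: x) = c^* *: unitz_star x.
Proof. by case: x => a x; congr pair; rewrite /= ?rmorphM ?starZ. Qed.
Fact unitz_starM x y :
  unitz_star (unitz_mul x y) = unitz_mul (unitz_star y) (unitz_star x).
Proof.
case: x y => [a x] [b y]; congr pair; first by rewrite /= rmorphM mulrC.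
by rewrite /= !starD !starZ starM [X in X + _]addrC.
Qed.
Fact unitz_starK : involutive unitz_star.
Proof. by move=> [a x]; congr pair; rewrite /= ?conjCK ?starK. Qed.

HB.instance Definition _ := isStarAlg.Build C unitization unitz_mulA unitz_mulDl
  unitz_mulDr unitz_mulZl unitz_mulZr unitz_starD unitz_starZ unitz_starM
  unitz_starK.

Definition unital_ext (phi : A -> C) (x : unitization) : C := x.1 + phi x.2.

Definition state (phi : A -> C) : Prop :=
  scalar phi /\ forall x : unitization, 0 <= unital_ext phi (star x ⋅ x).

End Unitization.

(* The free product is the quotient of formal star-algebra expressions in
   elements of [A] and [B] by the least congruence that makes it a star-algebra
   receiving star-homomorphisms from [A] and [B]; see [coprodP]. *)
Section FreeProductAlgebra.
Variables (C : numClosedFieldType) (A B : starAlgType C).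

Inductive expr : Type :=
  | EL of A
  | ER of B
  | EZero
  | EAdd of expr & expr
  | EScale of C & expr
  | EMul of expr & expr
  | EStar of expr.

Inductive econg : expr -> expr -> Prop :=
  | econg_refl s : econg s s
  | econg_sym s t : econg s t -> econg t s
  | econg_trans s t u : econg s t -> econg t u -> econg s u
  | econg_add s s' t t' : econg s s' -> econg t t' -> econg (EAdd s t) (EAdd s' t')
  | econg_scale c s s' : econg s s' -> econg (EScale c s) (EScale c s')
  | econg_mul s s' t t' : econg s s' -> econg t t' -> econg (EMul s t) (EMul s' t')
  | econg_star s s' : econg s s' -> econg (EStar s) (EStar s')
  | econg_addA s t u : econg (EAdd s (EAdd t u)) (EAdd (EAdd s t) u)
  | econg_addC s t : econg (EAdd s t) (EAdd t s)
  | econg_add0 s : econg (EAdd EZero s) s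
  | econg_addN s : econg (EAdd (EScale (-1) s) s) EZero
  | econg_scaleA c d s : econg (EScale c (EScale d s)) (EScale (c * d) s)
  | econg_scale1 s : econg (EScale 1 s) s
  | econg_scaleDr c s t :
      econg (EScale c (EAdd s t)) (EAdd (EScale c s) (EScale c t))
  | econg_scaleDl s c d : econg (EScale (c + d) s) (EAdd (EScale c s) (EScale d s))
  | econg_mulA s t u : econg (EMul s (EMul t u)) (EMul (EMul s t) u)
  | econg_mulDl s t u : econg (EMul (EAdd s t) u) (EAdd (EMul s u) (EMul t u))
  | econg_mulDr s t u : econg (EMul s (EAdd t u)) (EAdd (EMul s t) (EMul s u))
  | econg_mulZl c s t : econg (EMul (EScale c s) t) (EScale c (EMul s t))
  | econg_mulZr c s t : econg (EMul s (EScale c t)) (EScale c (EMul s t))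
  | econg_starD s t : econg (EStar (EAdd s t)) (EAdd (EStar s) (EStar t))
  | econg_starZ c s : econg (EStar (EScale c s)) (EScale (c^*) (EStar s))
  | econg_starM s t : econg (EStar (EMul s t)) (EMul (EStar t) (EStar s))
  | econg_starK s : econg (EStar (EStar s)) s
  | econg_LD c a b : econg (EL (c *: a + b)) (EAdd (EScale c (EL a)) (EL b))
  | econg_LM a b : econg (EL (a ⋅ b)) (EMul (EL a) (EL b))
  | econg_Lstar a : econg (EL (star a)) (EStar (EL a))
  | econg_RD c a b : econg (ER (c *: a + b)) (EAdd (EScale c (ER a)) (ER b))
  | econg_RM a b : econg (ER (a ⋅ b)) (EMul (ER a) (ER b))
  | econg_Rstar a : econg (ER (star a)) (EStar (ER a)).

HB.instance Definition _ := gen_eqMixin expr.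
HB.instance Definition _ := gen_choiceMixin expr.

Definition econgb : rel expr := fun s t => `[< econg s t >].

Fact econgb_refl : reflexive econgb.
Proof. by move=> s; apply/asboolP/econg_refl. Qed.
Fact econgb_sym : symmetric econgb.
Proof. by move=> s t; apply/asboolP/asboolP; apply: econg_sym. Qed.
Fact econgb_trans : transitive econgb.
Proof. by move=> t s u /asboolP st /asboolP tu; apply/asboolP/(econg_trans st tu). Qed.

Canonical econg_equiv := EquivRel econgb econgb_refl econgb_sym econgb_trans.

Definition coprod := {eq_quot econgb}%qT.
HB.instance Definition _ := Choice.on coprod.

Definition cls (s : expr) : coprod := (\pi_coprod s)%qT.
Definition rep (x : coprod) : expr := repr x.

Lemma repK x : cls (rep x) = x. Proof. exact: reprK. Qed.

Lemma clsP s t : cls s = cls t <-> econg s t.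
Proof.
split=> [/eqquotP/asboolP //|st].
by apply/eqquotP/asboolP.
Qed.

Lemma rep_cls s : econg (rep (cls s)) s. Proof. by apply/clsP; rewrite repK. Qed.

Definition cadd x y := cls (EAdd (rep x) (rep y)).
Definition copp x := cls (EScale (-1) (rep x)).
Definition cscale c x := cls (EScale c (rep x)).
Definition cmul x y := cls (EMul (rep x) (rep y)).
Definition cstar x := cls (EStar (rep x)).

Lemma caddE s t : cadd (cls s) (cls t) = cls (EAdd s t).
Proof. by apply/clsP/econg_add; apply: rep_cls. Qed.
Lemma coppE s : copp (cls s) = cls (EScale (-1) s).
Proof. by apply/clsP/econg_scale; apply: rep_cls. Qed.
Lemma cscaleE c s : cscale c (cls s) = cls (EScale c s).
Proof. by apply/clsP/econg_scale; apply: rep_cls. Qed.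
Lemma cmulE s t : cmul (cls s) (cls t) = cls (EMul s t).
Proof. by apply/clsP/econg_mul; apply: rep_cls. Qed.
Lemma cstarE s : cstar (cls s) = cls (EStar s).
Proof. by apply/clsP/econg_star; apply: rep_cls. Qed.
Let cE := (caddE, coppE, cscaleE, cmulE, cstarE).

Fact caddA : associative cadd.
Proof.
by move=> x y z; rewrite -[x]repK -[y]repK -[z]repK !cE; apply/clsP; constructor.
Qed.
Fact caddC : commutative cadd.
Proof. by move=> x y; rewrite -[x]repK -[y]repK !cE; apply/clsP; constructor. Qed.
Fact cadd0 : left_id (cls EZero) cadd.
Proof. by move=> x; rewrite -[x]repK !cE; apply/clsP; constructor. Qed.
Fact caddN : left_inverse (cls EZero) copp cadd.
Proof. by move=> x; rewrite -[x]repK !cE; apply/clsP; constructor. Qed.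
HB.instance Definition _ := GRing.isZmodule.Build coprod caddA caddC cadd0 caddN.

Fact cscaleA c d x : cscale c (cscale d x) = cscale (c * d) x.
Proof. by rewrite -[x]repK !cE; apply/clsP; constructor. Qed.
Fact cscale1 : left_id 1 cscale.
Proof. by move=> x; rewrite -[x]repK !cE; apply/clsP; constructor. Qed.
Fact cscaleDr : right_distributive cscale cadd.
Proof.
by move=> c x y; rewrite -[x]repK -[y]repK !cE; apply/clsP; constructor.
Qed.
Fact cscaleDl x : {morph cscale^~ x : c d / c + d >-> cadd c d}.
Proof. by move=> c d; rewrite -[x]repK !cE; apply/clsP; constructor. Qed.
HB.instance Definition _ := GRing.Zmodule_isLmodule.Build C coprod
  cscaleA cscale1 cscaleDr cscaleDl.

Fact cmulA : associative cmul.
Proof.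
by move=> x y z; rewrite -[x]repK -[y]repK -[z]repK !cE; apply/clsP; constructor.
Qed.
Fact cmulDl : left_distributive cmul cadd.
Proof.
by move=> x y z; rewrite -[x]repK -[y]repK -[z]repK !cE; apply/clsP; constructor.
Qed.
Fact cmulDr : right_distributive cmul cadd.
Proof.
by move=> x y z; rewrite -[x]repK -[y]repK -[z]repK !cE; apply/clsP; constructor.
Qed.
Fact cmulZl (c : C) x y : cmul (cscale c x) y = cscale c (cmul x y).
Proof. by rewrite -[x]repK -[y]repK !cE; apply/clsP; constructor. Qed.
Fact cmulZr (c : C) x y : cmul x (cscale c y) = cscale c (cmul x y).
Proof. by rewrite -[x]repK -[y]repK !cE; apply/clsP; constructor. Qed.
Fact cstarD : {morph cstar : x y / cadd x y}.
Proof. by move=> x y; rewrite -[x]repK -[y]repK !cE; apply/clsP; constructor. Qed.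
Fact cstarZ (c : C) x : cstar (cscale c x) = cscale (c^*) (cstar x).
Proof. by rewrite -[x]repK !cE; apply/clsP; constructor. Qed.
Fact cstarM x y : cstar (cmul x y) = cmul (cstar y) (cstar x).
Proof. by rewrite -[x]repK -[y]repK !cE; apply/clsP; constructor. Qed.
Fact cstarK : involutive cstar.
Proof. by move=> x; rewrite -[x]repK !cE; apply/clsP; constructor. Qed.
HB.instance Definition _ := isStarAlg.Build C coprod
  cmulA cmulDl cmulDr cmulZl cmulZr cstarD cstarZ cstarM cstarK.

Definition coprodl (a : A) : coprod := cls (EL a).
Definition coprodr (b : B) : coprod := cls (ER b).

End FreeProductAlgebra.

Notation "A ⊔ B" := (coprod A B) (at level 50, left associativity) : type_scope.

Definition is_coproduct (C : numClosedFieldType) (A B P : starAlgType C)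
    (i : A -> P) (j : B -> P) : Prop :=
  [/\ star_hom i, star_hom j &
    forall (D : starAlgType C) (f : A -> D) (g : B -> D), star_hom f -> star_hom g ->
    exists! h : P -> D, [/\ star_hom h, h \o i =1 f & h \o j =1 g]].

Section CoproductTheory.
Variables (C : numClosedFieldType) (A B D : starAlgType C).

Lemma star_hom0 (f : A -> D) : star_hom f -> f 0 = 0.
Proof.
case=> + _ _ => /(_ (-1) 0 0).
by rewrite scaler0 addr0 scaleN1r addNr.
Qed.

Lemma star_homD (f : A -> D) : star_hom f -> {morph f : a b / a + b}.
Proof. by case=> fl _ _ a b; have := fl 1 a b; rewrite !scale1r. Qed.

Lemma star_homZ (f : A -> D) : star_hom f -> forall c a, f (c *: a) = c *: f a.
Proof.
by move=> fh c a; case: (fh) => fl _ _; have := fl c a 0; rewrite (star_hom0 fh) !addr0.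
Qed.

Variables (f : A -> D) (g : B -> D).

Fixpoint eval (s : expr A B) : D :=
  match s with
  | EL a => f a
  | ER b => g b
  | EZero => 0
  | EAdd s t => eval s + eval t
  | EScale c s => c *: eval s
  | EMul s t => eval s ⋅ eval t
  | EStar s => star (eval s)
  end.

Hypotheses (fh : star_hom f) (gh : star_hom g).

Lemma eval_econg s t : econg s t -> eval s = eval t.
Proof.
case: (fh) (gh) => [fl fm fs] [gl gm gs].
elim=> //= *; rewrite ?(addrA, add0r, scaleN1r, addNr, scalerA, scale1r) //;
  try congruence.
- exact: addrC.
- exact: scalerDr.
- exact: scalerDl.
- exact: smulA.
- exact: smulDl.
- exact: smulDr.
- exact: smulZl.
- exact: smulZr.
- exact: starD.
- exact: starZ.
- exact: starM.
- exact: starK.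
Qed.

Lemma eval_hom : star_hom (fun x : A ⊔ B => eval (rep x)).
Proof.
split=> [c x y|x y|x].
- exact: (eval_econg (econg_trans (rep_cls _) (econg_add (rep_cls _) (econg_refl _)))).
- exact: (eval_econg (rep_cls _)).
- exact: (eval_econg (rep_cls _)).
Qed.

End CoproductTheory.

Lemma coprodP (C : numClosedFieldType) (A B : starAlgType C) :
  is_coproduct (@coprodl C A B) (@coprodr C A B).
Proof.
have Eadd (s t : expr A B) : cls s + cls t = cls (EAdd s t) by exact: caddE.
have Escale c (s : expr A B) : c *: cls s = cls (EScale c s) by exact: cscaleE.
have Emul (s t : expr A B) : cls s ⋅ cls t = cls (EMul s t) by exact: cmulE.
have Estar (s : expr A B) : star (cls s) = cls (EStar s) by exact: cstarE.
split.
- by split=> [c a b|a b|a]; rewrite /coprodl ?Escale ?Eadd ?Emul ?Estar;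
    apply/clsP; constructor.
- by split=> [c a b|a b|a]; rewrite /coprodr ?Escale ?Eadd ?Emul ?Estar;
    apply/clsP; constructor.
move=> D f g fh gh; exists (fun x => eval f g (rep x)); split.
  split; first exact: eval_hom.
  - by move=> a; exact: (eval_econg fh gh (rep_cls (EL B a))).
  - by move=> b; exact: (eval_econg fh gh (rep_cls (ER A b))).
move=> h [hh hi hj]; apply/funext => x; rewrite -[in RHS](repK x).
case: (hh) => _ hM hS.
elim: (rep x) => /= [a|b||s IHs t IHt|c s IHs|s IHs t IHt|s IHs].
- by rewrite -hi.
- by rewrite -hj.
- by rewrite -[LHS](star_hom0 hh).
- by rewrite -Eadd (star_homD hh) IHs IHt.
- by rewrite -Escale (star_homZ hh) IHs.
- by rewrite -Emul hM IHs IHt.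
- by rewrite -Estar hS IHs.
Qed.

(** * Two-faced star-algebras *)

(* The star-subalgebras A^(1), A^(2) are given by their inclusions into A;
   the faces, like all two-element index sets below, are indexed by [bool],
   with [false] for the index 1 and [true] for the index 2. *)
Record twoFaced (C : numClosedFieldType) := TwoFaced {
  tf_alg :> starAlgType C;
  face : bool -> starAlgType C;
  face_incl : forall i, face i -> tf_alg;
  face_inj : forall i, injective (@face_incl i);
  face_coproduct : is_coproduct (@face_incl false) (@face_incl true)
}.

(** * Pre-Hilbert spaces spanned by a positive kernel *)

Section PositiveKernels.
Variable C : numClosedFieldType.

Definition psd X (k : X -> X -> C) : Prop := forall s : seq (C * X),
  0 <= \sum_(p <- s) \sum_(q <- s) p.1^* * q.1 * k p.2 q.2.

Lemma psd_ord X (k : X -> X -> C) n (c : 'I_n -> C) (x : 'I_n -> X) : psd k ->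
  0 <= \sum_i \sum_j (c i)^* * c j * k (x i) (x j).
Proof.
move=> /(_ [seq (c i, x i) | i <- index_enum 'I_n]); rewrite big_map /=.
by congr (0 <= _); apply: eq_bigr => i _; rewrite big_map.
Qed.

Lemma psd_mul X (k1 k2 : X -> X -> C) : (forall x y, k1 y x = (k1 x y)^*) ->
  psd k1 -> psd k2 -> psd (fun x y => k1 x y * k2 x y).
Proof.
move=> herm psd1 psd2 s; set n := size s.
pose c (i : 'I_n) := (tnth (in_tuple s) i).1.
pose x (i : 'I_n) := (tnth (in_tuple s) i).2.
pose A : 'M[C]_n := \matrix_(i, j) k1 (x i) (x j).
have An : A \is normalmx.
  have AE : A^t* %sesqui = A by apply/matrixP => i j; rewrite !mxE -herm.
  by apply/normalmxP; rewrite AE.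
have /orthomx_spectralP AE := An.
set P := spectralmx A in AE; set d := spectral_diag A in AE.
have Pu : P \is unitarymx by exact: spectral_unitarymx.
rewrite invmx_unitary // in AE.
have Aij i j : A i j = \sum_l d 0 l * ((P l i)^* * P l j).
  rewrite AE mxE; apply: eq_bigr => l _; rewrite mxE (bigD1 l) //= !mxE.
  rewrite eqxx mulr1n big1 ?addr0 => [|m ml]; last first.
    by rewrite !mxE (negPf ml) mulr0n mulr0.
  by rewrite mulrCA mulrA.
have d_ge0 l : 0 <= d 0 l.
  have : P *m A *m P^t* %sesqui = diag_mx d.
    rewrite AE !mulmxA (unitarymxP Pu) mul1mx -mulmxA.
    by rewrite (unitarymxP Pu) mulmx1.
  move/matrixP => /(_ l l); rewrite [RHS]mxE eqxx mulr1n => <-.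
  rewrite mxE; under eq_bigr do rewrite mxE mulr_suml.
  rewrite exchange_big /=.
  have := psd_ord (fun i => (P l i)^*) x psd1.
  congr (0 <= _); apply: eq_bigr => i _; apply: eq_bigr => j _.
  by rewrite conjCK !mxE mulrAC.
have -> : \sum_(p <- s) \sum_(q <- s) p.1^* * q.1 * (k1 p.2 q.2 * k2 p.2 q.2) =
    \sum_l d 0 l * \sum_i \sum_j (P l i * c i)^* * (P l j * c j) * k2 (x i) (x j).
  rewrite big_tnth; under eq_bigr do rewrite big_tnth.
  rewrite -/n; under [RHS]eq_bigr do rewrite mulr_sumr.
  rewrite [RHS]exchange_big /=; apply: eq_bigr => i _.
  under [RHS]eq_bigr do rewrite mulr_sumr.
  rewrite [RHS]exchange_big /=; apply: eq_bigr => j _.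
  have -> : k1 (tnth (in_tuple s) i).2 (tnth (in_tuple s) j).2 = A i j by rewrite mxE.
  rewrite Aij mulr_suml mulr_sumr; apply: eq_bigr => l _.
  by rewrite rmorphM /= -/(c i) -/(c j) -/(x i) -/(x j); ring.
by apply: sumr_ge0 => l _; rewrite mulr_ge0 // psd_ord.
Qed.

Lemma psd_gram X (H : preHilbertType C) (f : X -> H) :
  psd (fun x y => ⟨f x, f y⟩).
Proof.
move=> s; have := inner_ge0 (\sum_(p <- s) p.1 *: f p.2).
rewrite inner_suml; congr (0 <= _); apply: eq_bigr => p _.
by rewrite inner_sumr; apply: eq_bigr => q _; rewrite innerZl innerZr mulrA.
Qed.

Lemma psd_add X (k1 k2 : X -> X -> C) :
  psd k1 -> psd k2 -> psd (fun x y => k1 x y + k2 x y).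
Proof.
move=> psd1 psd2 s; have := addr_ge0 (psd1 s) (psd2 s).
rewrite -big_split; congr (0 <= _); apply: eq_bigr => p _.
by rewrite -big_split; apply: eq_bigr => q _; rewrite mulrDr.
Qed.

Lemma psd_pull X Y (h : Y -> X) (k : X -> X -> C) :
  psd k -> psd (fun x y => k (h x) (h y)).
Proof.
move=> /[swap] s /(_ [seq (p.1, h p.2) | p <- s]); rewrite big_map /=.
by congr (0 <= _); apply: eq_bigr => p _; rewrite big_map.
Qed.

End PositiveKernels.

Record kernel (C : numClosedFieldType) (X : Type) := Kernel {
  kfun :> X -> X -> C;
  kherm : forall x y, kfun y x = (kfun x y)^*;
  kpsd : psd kfun;
  kpoint : X;
  kpoint1 : kfun kpoint kpoint = 1
}.

(* [kspace k] is the linear span of the functions [k^~ x], with the inner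
   product determined by ⟨k^~ x, k^~ y⟩ = k x y. It is the universal complex
   vector space on X modulo the null space of the form k. *)
Section KernelSpace.
Variables (C : numClosedFieldType) (X : Type) (k : kernel C X).

Definition kcomb (s : seq (C * X)) : X -> C^o :=
  fun y => \sum_(p <- s) p.1 * k y p.2.

Definition kspan : {pred X -> C^o} := fun f => `[< exists s, f = kcomb s >].

Fact kspan_closed : subsemimod_closed kspan.
Proof.
split; first split.
- by apply/asboolP; exists [::]; apply/funext => y; rewrite /kcomb big_nil.
- move=> _ _ /asboolP[s ->] /asboolP[t ->]; apply/asboolP; exists (s ++ t).
  by apply/funext => y; rewrite /kcomb big_cat.
- move=> a _ /asboolP[s ->]; apply/asboolP; exists [seq (a * p.1, p.2) | p <- s].
  apply/funext => y; rewrite /kcomb big_map /=.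
  rewrite [LHS]mulr_sumr; apply: eq_bigr => p _; exact: mulrA.
Qed.
HB.instance Definition _ := GRing.isSubmodClosed.Build C (X -> C^o) kspan
  kspan_closed.

Record kspace := KSpace { kval :> X -> C^o; _ : kval \in kspan }.

HB.instance Definition _ := [isSub for kval].
HB.instance Definition _ := [Choice of kspace by <:].
HB.instance Definition _ := [SubChoice_isSubLmodule of kspace by <:].
Implicit Types f g : kspace.

Lemma kspanP f : exists s, (f : X -> C^o) = kcomb s.
Proof. by case: f => f /= /asboolP. Qed.

Fact kgen_subproof x : (k^~ x : X -> C^o) \in kspan.
Proof.
by apply/asboolP; exists [:: (1, x)]; apply/funext => y; rewrite /kcomb big_seq1 mul1r.
Qed.
Definition kgen x : kspace := KSpace (kgen_subproof x).

Definition kspan_rep f : seq (C * X) := projT1 (cid (kspanP f)).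

Lemma kspan_repE f x : f x = \sum_(p <- kspan_rep f) p.1 * k x p.2.
Proof. by rewrite /kspan_rep; case: cid => s /= {1}->. Qed.

Definition kinner f g : C := \sum_(p <- kspan_rep f) p.1^* * g p.2.

Fact kinner_linear f (a : C) g h : kinner f (a *: g + h) = a * kinner f g + kinner f h.
Proof.
rewrite /kinner mulr_sumr -big_split; apply: eq_bigr => p _ /=.
rewrite [X in _ * X](_ : _ = a * g p.2 + h p.2) //; ring.
Qed.

Fact kinner_conj f g : kinner g f = (kinner f g)^*.
Proof.
rewrite /kinner rmorph_sum /=.
under eq_bigr => p _ do rewrite kspan_repE mulr_sumr.
rewrite exchange_big /=; apply: eq_bigr => q _.
rewrite rmorphM /= conjCK kspan_repE rmorph_sum mulr_sumr; apply: eq_bigr => p _ /=.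
by rewrite rmorphM /= -kherm; ring.
Qed.

Fact kinner_genr f x : kinner f (kgen x) = (f x)^*.
Proof.
rewrite /kinner kspan_repE rmorph_sum; apply: eq_bigr => p _ /=.
by rewrite rmorphM /= -kherm.
Qed.

Fact kinner_genl f x : kinner (kgen x) f = f x.
Proof. by rewrite kinner_conj kinner_genr conjCK. Qed.

Fact kinner_ge0 f : 0 <= kinner f f.
Proof.
have := kpsd k (kspan_rep f); congr (0 <= _); apply: eq_bigr => p _.
by rewrite kspan_repE mulr_sumr; apply: eq_bigr => q _; rewrite mulrA.
Qed.

Fact kinner_eq0 f : kinner f f = 0 -> f = 0.
Proof.
move=> f0; apply/val_inj/funext => x /=; rewrite -/(f x).
pose b := k x x.
have b_ge0 : 0 <= b by have := kinner_ge0 (kgen x); rewrite kinner_genl.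
have ipDl (u v w : kspace) (c : C) :
    kinner (c *: u + v) w = c^* * kinner u w + kinner v w.
  by rewrite kinner_conj kinner_linear rmorphD rmorphM /= -!kinner_conj.
have ge0 (t : C) : t \is Num.real ->
    0 <= b * `|f x| ^+ 2 * t ^+ 2 - 2 * t * `|f x| ^+ 2.
  move=> /conj_Creal tr.
  have := kinner_ge0 ((- t * f x) *: kgen x + f); congr (0 <= _).
  rewrite ipDl !kinner_linear f0 !kinner_genl kinner_genr rmorphM rmorphN /= tr.
  by rewrite /b normCK /=; ring.
apply/eqP; rewrite -normr_eq0; apply: contraT => n0.
have fx_gt0 : 0 < `|f x| ^+ 2 by rewrite exprn_gt0 // normr_gt0 -normr_eq0.
have b1_gt0 : 0 < b + 1 by rewrite ltr_wpDl.
have t_gt0 : 0 < (b + 1)^-1 by rewrite invr_gt0.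
have := ge0 (b + 1)^-1 (gtr0_real t_gt0).
have -> : b * `|f x| ^+ 2 * (b + 1)^-1 ^+ 2 - 2 * (b + 1)^-1 * `|f x| ^+ 2 =
    - (`|f x| ^+ 2 * ((b + 2) * (b + 1)^-1 ^+ 2)).
  by field; rewrite gt_eqF.
rewrite oppr_ge0 => /le_gtF; rewrite mulr_gt0 //.
by rewrite mulr_gt0 ?exprn_gt0 // ltr_wpDl.
Qed.

Fact kinner_vac : kinner (kgen (kpoint k)) (kgen (kpoint k)) = 1.
Proof. by rewrite kinner_genl /= kpoint1. Qed.

HB.instance Definition _ := isPreHilbert.Build C kspace kinner_linear kinner_conj
  kinner_ge0 kinner_eq0 kinner_vac.

Lemma inner_genl x f : ⟨kgen x, f⟩ = f x. Proof. exact: kinner_genl. Qed.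
Lemma inner_genr x f : ⟨f, kgen x⟩ = (f x)^*. Proof. exact: kinner_genr. Qed.

Lemma kspaceE f : f = \sum_(p <- kspan_rep f) p.1 *: kgen p.2.
Proof.
apply: inner_inj => g; rewrite inner_sumr inner_conj [LHS]rmorph_sum /=.
by apply: eq_bigr => p _; rewrite innerZr rmorphM /= conjCK inner_genr.
Qed.

End KernelSpace.

(* An adjointable operator on [kspace k] is given by its values on the
   generators [kgen x]. *)
Section KernelOperator.
Variables (C : numClosedFieldType) (X : Type) (k : kernel C X).
Variables (K : preHilbertType C) (phi : X -> K).

Definition kext (f : kspace k) : K := \sum_(p <- kspan_rep f) p.1 *: phi p.2.

Definition kadjointable := forall y, (fun x => ⟨phi x, y⟩ : C^o) \in kspan k.

Hypothesis phiP : kadjointable.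

Lemma kop_subproof y (f : kspace k) : ⟨KSpace (phiP y), f⟩ = ⟨y, kext f⟩.
Proof.
rewrite inner_conj [⟨f, _⟩]/inner /= /kinner rmorph_sum inner_sumr.
by apply: eq_bigr => p _; rewrite rmorphM /= conjCK innerZr -inner_conj.
Qed.

Definition kop : Ladj (kspace k) K := mkL kop_subproof.

Lemma kopE x : kop (kgen k x) = phi x.
Proof.
by apply: inner_inj => y; rewrite -kop_subproof inner_genr /= -inner_conj.
Qed.

End KernelOperator.

Lemma kadjointable_gen (C : numClosedFieldType) (X Y : Type) (k : kernel C X)
    (l : kernel C Y) (phi : X -> kspace l) :
  (forall y, exists f : kspace k, forall x, ⟨phi x, kgen l y⟩ = f x) ->
  kadjointable k phi.
Proof.
move=> phiP z; rewrite (kspaceE z).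
have -> : (fun x => ⟨phi x, \sum_(p <- kspan_rep z) p.1 *: kgen l p.2⟩ : C^o) =
    \sum_(p <- kspan_rep z) p.1 *: (fun x => ⟨phi x, kgen l p.2⟩ : C^o).
  apply/funext => x; rewrite inner_sumr fct_sumE; apply: eq_bigr => p _.
  by rewrite innerZr.
apply: rpred_sum => p _; apply: rpredZ.
have [f fP] := phiP p.2.
suff -> : (fun x => ⟨phi x, kgen l p.2⟩ : C^o) = f by exact: (valP f).
by apply/funext.
Qed.

(** * Algebraic tensor products *)

(* The algebraic tensor product is realized as a space of functions, with x ⊗ y
   the function (h, k) ↦ ⟨h, x⟩ ⟨k, y⟩; this is faithful because the inner
   products are nondegenerate. *)
Section Tensor.
Variables (C : numClosedFieldType) (H K : preHilbertType C).

Definition tensor_fun (p q : H * K) : C := ⟨p.1, q.1⟩ * ⟨p.2, q.2⟩.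

Fact tensor_herm p q : tensor_fun q p = (tensor_fun p q)^*.
Proof. by rewrite /tensor_fun rmorphM /= -!inner_conj. Qed.
Fact tensor_psd : psd tensor_fun.
Proof.
by apply: psd_mul => [p q||]; [exact: inner_conj|exact: psd_gram|exact: psd_gram].
Qed.
Fact tensor_point : tensor_fun (Ω, Ω) (Ω, Ω) = 1.
Proof. by rewrite /tensor_fun !inner_vac mulr1. Qed.

Definition tensor_kernel : kernel C (H * K) :=
  Kernel tensor_herm tensor_psd tensor_point.

Definition tensor := kspace tensor_kernel.
HB.instance Definition _ := PreHilbert.on tensor.

Definition tens (x : H) (y : K) : tensor := kgen tensor_kernel (x, y).

Lemma inner_tens x y x' y' : ⟨tens x y, tens x' y'⟩ = ⟨x, x'⟩ * ⟨y, y'⟩.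
Proof. by rewrite inner_genl. Qed.

Lemma tens_linear x : linear (tens x).
Proof.
move=> a y z; apply/val_inj/funext => p.
rewrite /= /tensor_fun /= innerDr innerZr.
by rewrite mulrDr mulrCA.
Qed.
HB.instance Definition _ x := GRing.isLinear.Build C K tensor _ (tens x)
  (tens_linear x).

Lemma tens_linearl y : linear (tens^~ y).
Proof.
move=> a x z; apply/val_inj/funext => p.
rewrite /= /tensor_fun /= innerDr innerZr.
by rewrite mulrDl -mulrA.
Qed.

End Tensor.

Notation "H ⊗ K" := (tensor H K) (at level 40, left associativity) : type_scope.
Notation "x ⊗ y" := (tens x y) (at level 40, left associativity) : ring_scope.

Section TensorOperator.
Variables (C : numClosedFieldType) (H K : preHilbertType C).
Variables (T : 'L(H)) (S : 'L(K)).

Fact Ltens_subproof :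
  kadjointable (tensor_kernel H K) (fun p : H * K => (T p.1 ⊗ S p.2 : H ⊗ K)%R).
Proof.
apply: kadjointable_gen => -[h k]; exists (T^† h ⊗ S^† k) => -[x y].
by rewrite -[kgen _ _]/(h ⊗ k) inner_tens /= /tensor_fun /= !dagPr.
Qed.

Definition Ltens : 'L(H ⊗ K) := kop Ltens_subproof.

Lemma LtensE x y : Ltens (x ⊗ y) = T x ⊗ S y.
Proof. exact: kopE. Qed.

End TensorOperator.

(** * The free product of pre-Hilbert spaces *)

Section FreeProductSpace.
Variables (C : numClosedFieldType) (H : bool -> preHilbertType C).

Definition letter := {i : bool & H i}.
Definition mkletter i (x : H i) : letter := existT (fun j => H j : Type) i x.

(* [F x] if the letter is the vector x of the space H_i, else [d]. *)
Definition letter_case R (d : R) i (F : H i -> R) (a : letter) : R :=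
  @untag bool (fun j => H j : Type) R d i F a.

Lemma letter_caseE R (d : R) i (F : H i -> R) x :
  letter_case d F (mkletter x) = F x.
Proof. exact: (untagE _ _ (erefl i : tag (mkletter x) = i)). Qed.

Lemma letter_case_dflt R (d : R) i (F : H i -> R) a :
  tag a != i -> letter_case d F a = d.
Proof. exact: untag_dflt. Qed.


Definition alternating (w : seq letter) : bool :=
  sorted (fun i j => i != j) (map tag w).
Definition centered (w : seq letter) : bool :=
  all (fun l : letter => ⟨Ω, tagged l⟩ == 0) w.

(* The words indexing the elementary tensors of H_1 * H_2 (for [o = None]) and of
   H(l) (for [o = Some l]). *)
Definition word_pred (o : option bool) (w : seq letter) : bool :=
  [&& alternating w, centered w & (o == None) || (ohead (map tag w) != o)].
Definition word o := {w : seq letter | word_pred o w}.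

Definition letter_fun (a b : letter) : C :=
  if tag a == tag b then ⟨tagged a, tagged_as a b⟩ else 0.

Fixpoint word_fun (u v : seq letter) : C :=
  match u, v with
  | [::], [::] => 1
  | a :: u', b :: v' => letter_fun a b * word_fun u' v'
  | _, _ => 0
  end.

Lemma letter_funE i (x y : H i) :
  letter_fun (mkletter x) (mkletter y) = ⟨x, y⟩.
Proof. by rewrite /letter_fun eqxx tagged_asE. Qed.

Lemma letter_fun_neq a b : tag a != tag b -> letter_fun a b = 0.
Proof. by rewrite /letter_fun => /negPf->. Qed.

Fact letter_fun_conj a b : letter_fun b a = (letter_fun a b)^*.
Proof.
case: a b => [i x] [j y]; case: (eqVneq i j) => [ij|ij].
  by subst j; rewrite !letter_funE inner_conj.
by rewrite !letter_fun_neq ?rmorph0 // eq_sym.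
Qed.

Fact word_fun_conj u v : word_fun v u = (word_fun u v)^*.
Proof.
elim: u v => [|a u IH] [|b v] /=; rewrite ?rmorph0 ?rmorph1 //.
by rewrite IH letter_fun_conj -rmorphM.
Qed.

Let head_vec i (u : seq letter) : H i :=
  if u is l :: _ then letter_case 0 id l else 0.
Let head_fun (u v : seq letter) : C :=
  ⟨head_vec false u, head_vec false v⟩ + ⟨head_vec true u, head_vec true v⟩.

Fixpoint trunc_fun n (u v : seq letter) : C := (nilp u)%:R^* * (nilp v)%:R +
  if n is n'.+1 then head_fun u v * trunc_fun n' (behead u) (behead v) else 0.

Let head_funE a b u v : head_fun (a :: u) (b :: v) = letter_fun a b.
Proof.
rewrite /head_fun /head_vec /= /letter_fun; case: a b => [i x] [j y] /=.
case: i j x y => [] [] x y; 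
  rewrite -!/(mkletter _) ?letter_caseE ?(@letter_case_dflt _ _ true) //
    ?(@letter_case_dflt _ _ false) //.
- by rewrite inner0l add0r -letter_funE.
- by rewrite /= inner0l inner0r addr0.
- by rewrite /= inner0l inner0r addr0.
- by rewrite inner0r addr0 -letter_funE.
Qed.

Let trunc_funE n u v : (size u <= n)%N -> trunc_fun n u v = word_fun u v.
Proof.
elim: n u v => [|n IH] [|a u] [|b v] //= su; rewrite ?rmorph1 ?rmorph0;
  rewrite ?(mul0r, mulr0, mul1r, addr0, add0r) //.
- by rewrite /head_fun /= !inner0l addr0 mul0r addr0.
- by rewrite /head_fun /= !inner0l addr0 mul0r.
- by rewrite /head_fun /= !inner0r addr0 mul0r.
- by rewrite head_funE IH.
Qed.

Let trunc_fun_psd n : psd (trunc_fun n).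
Proof.
have nil_psd : psd (fun u v : seq letter => (nilp u)%:R^* * (nilp v)%:R : C).
  move=> s; have := mul_conjC_ge0 (\sum_(p <- s) p.1 * (nilp p.2)%:R).
  rewrite mulrC rmorph_sum mulr_suml; congr (0 <= _); apply: eq_bigr => p _ /=.
  rewrite mulr_sumr; apply: eq_bigr => q _; rewrite rmorphM /=; ring.
have head_psd : psd head_fun.
  by apply: psd_add; exact: (psd_gram (head_vec _)).
elim: n => [|n IH]; apply: psd_add => //=.
  by move=> s; rewrite big1 // => p _; rewrite big1 // => q _; rewrite mulr0.
apply: psd_mul => //; last exact: (psd_pull behead IH).
by move=> u v; rewrite /head_fun rmorphD /= -!inner_conj.
Qed.

Fact word_fun_psd : psd word_fun.
Proof.
move=> s; have := @trunc_fun_psd (\max_(p <- s) size p.2) s.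
congr (0 <= _); apply: eq_big_seq => p ps; apply: eq_bigr => q _.
by rewrite trunc_funE //; exact: (@leq_bigmax_seq _ s xpredT (fun r => size r.2) p).
Qed.

Fact word_nil_subproof o : word_pred o [::].
Proof. by case: o. Qed.
Definition word_nil o : word o := exist _ [::] (word_nil_subproof o).

Definition word_kernel o : kernel C (word o) :=
  @Kernel C (word o) (fun u v => word_fun (val u) (val v))
    (fun u v => word_fun_conj (val u) (val v))
    (psd_pull val word_fun_psd) (word_nil o) erefl.

Definition alt_space o := kspace (word_kernel o).
HB.instance Definition _ o := PreHilbert.on (alt_space o).

(* The elementary tensor of the letters of w, and 0 if w is not an allowed word. *)
Definition elem o (w : seq letter) : alt_space o :=
  if insub w is Some w' then kgen (word_kernel o) w' else 0.

Lemma elemE o (w : word o) : elem o (val w) = kgen (word_kernel o) w.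
Proof. by rewrite /elem valK. Qed.

Lemma elem_nil o : elem o [::] = Ω.
Proof. exact: (elemE (word_nil o)). Qed.

Lemma inner_elem o u v : word_pred o u -> word_pred o v ->
  ⟨elem o u, elem o v⟩ = word_fun u v.
Proof.
move=> up vp; rewrite -[u]/(val (exist (word_pred o) u up : word o)).
rewrite -[v]/(val (exist (word_pred o) v vp : word o)) !elemE.
by rewrite inner_genl.
Qed.

(** ** The unitaries U, V and R *)

(* [split_gen false] is U and [split_gen true] is V on elementary tensors. *)
Definition split_gen (l : bool) (w : word None) : H l ⊗ alt_space (Some l) :=
  match val w with
  | [::] => Ω ⊗ Ω
  | a :: w' => letter_case (Ω ⊗ elem (Some l) (a :: w'))
                          (fun x : H l => x ⊗ elem (Some l) w') a
  end.

Definition rev_gen (w : word None) : alt_space None := elem None (rev (val w)).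

Definition center i (x : H i) : H i := x - ⟨Ω, x⟩ *: Ω.

Lemma inner_center i (x y : H i) : ⟨Ω, y⟩ = 0 -> ⟨y, center x⟩ = ⟨y, x⟩.
Proof.
by move=> y0; rewrite /center innerBr innerZr (inner_conj Ω y) y0 rmorph0 mulr0 subr0.
Qed.

Fact word_pred_None o w : word_pred o w -> word_pred None w.
Proof. by case/and3P => a c _; rewrite /word_pred a c. Qed.

Fact word_pred_cons l (x : H l) w : word_pred None (mkletter x :: w) =
  (⟨Ω, x⟩ == 0) && word_pred (Some l) w.
Proof.
rewrite /word_pred /alternating /centered /= !andbT /=.
case: w => [|a w] /=; first by rewrite !andbT.
have -> : (Some (tag a) != Some l) = (l != tag a) by rewrite eq_sym.
by case: (l != tag a); rewrite ?andbT ?andbF //= andbCA.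
Qed.

Fact split_subproof l : kadjointable (word_kernel None) (@split_gen l).
Proof.
apply: kadjointable_gen => -[h g].
pose hw (v : word (Some l)) : alt_space None :=
  ⟨Ω, h⟩ *: elem None (val v) + elem None (mkletter (center h) :: val v).
exists (\sum_(p <- kspan_rep g) p.1 *: hw p.2) => w.
rewrite -inner_genl inner_sumr -[kgen _ (h, g)]/(h ⊗ g) [in LHS](kspaceE g).
rewrite linear_sum inner_sumr; apply: eq_bigr => p _.
rewrite linearZ !innerZr; congr (_ * _).
case: p => _ [v vp] /=.
rewrite -[kgen _ (exist _ v vp)]elemE -[kgen _ w]elemE /hw /= innerDr innerZr.
have ch : ⟨Ω, center h⟩ = 0 by rewrite innerBr innerZr inner_vac mulr1 subrr.
have vN := word_pred_None vp.
have hvN : word_pred None (mkletter (center h) :: v).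
  by rewrite word_pred_cons ch eqxx.
case: w => -[|[i x] w] wp; rewrite /split_gen /=.
  by rewrite inner_tens -(elem_nil (Some l)) !inner_elem //= addr0.
rewrite !inner_elem //=; case: (eqVneq i l) => [il|il].
  subst i; rewrite letter_caseE.
  move: wp; rewrite word_pred_cons => /andP[/eqP x0 wp].
  rewrite inner_tens inner_elem // letter_funE inner_center //.
  case: v {hvN vN} vp => [|b v] vp; first by rewrite mulr0 add0r.
  rewrite letter_fun_neq ?mul0r ?mulr0 ?add0r //.
  by case/and3P: vp => _ _; rewrite /= eq_sym.
rewrite letter_case_dflt // inner_tens letter_fun_neq // mul0r addr0.
rewrite inner_elem //.
by case/and3P: wp => a c _; rewrite /word_pred a c.
Qed.

Definition Lsplit l : Ladj (alt_space None) (H l ⊗ alt_space (Some l))%type :=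
  kop (@split_subproof l).

Fact word_pred_rev w : word_pred None w -> word_pred None (rev w).
Proof.
case/and3P => a c _; rewrite /word_pred /= andbT; apply/andP; split.
  rewrite /alternating map_rev rev_sorted.
  by rewrite (eq_sorted (e' := fun i j => i != j)) // => i j; rewrite eq_sym.
by rewrite /centered all_rev.
Qed.

Fact word_fun_size u v : size u != size v -> word_fun u v = 0.
Proof. by elim: u v => [|a u IH] [|b v] //= uv; rewrite IH ?mulr0. Qed.

Fact word_fun_rev u v : word_fun (rev u) (rev v) = word_fun u v.
Proof.
have catE s t s' t' : size s = size t ->
    word_fun (s ++ s') (t ++ t') = word_fun s t * word_fun s' t'.
  elim: s t => [|a s IH] [|b t] //=; first by rewrite mul1r.
  by case=> st; rewrite IH // mulrA.
case: (eqVneq (size u) (size v)) => [|uv]; last first.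
  by rewrite !word_fun_size // !size_rev.
elim: u v => [|a u IH] [|b v] // [uv].
by rewrite !rev_cons -!cats1 catE ?size_rev //= IH // mulr1 mulrC.
Qed.

Fact rev_subproof : kadjointable (word_kernel None) rev_gen.
Proof.
apply: kadjointable_gen => v; exists (elem None (rev (val v))) => w.
have wp := valP w; have vp := valP v.
rewrite -inner_genl -!elemE /rev_gen !inner_elem ?word_pred_rev //.
by rewrite -word_fun_rev revK.
Qed.

Definition Lrev : 'L(alt_space None) := kop rev_subproof.

End FreeProductSpace.

Definition pair_family (C : numClosedFieldType) (H1 H2 : preHilbertType C)
  (i : bool) : preHilbertType C := if i then H2 else H1.

Definition free_space (C : numClosedFieldType) (H1 H2 : preHilbertType C) :=
  alt_space (pair_family H1 H2) None.
HB.instance Definition _ (C : numClosedFieldType) (H1 H2 : preHilbertType C) :=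
  PreHilbert.on (free_space H1 H2).

Notation "H1 ∗ H2" := (free_space H1 H2) (at level 40, left associativity) : type_scope.

(** * The lifts *)

Section Lifts.
Variable C : numClosedFieldType.

Fact Lvac_subproof (H : preHilbertType C) (x y : H) :
  ⟨⟨Ω, x⟩ *: Ω, y⟩ = ⟨x, ⟨Ω, y⟩ *: (Ω : H)⟩.
Proof. by rewrite innerZl innerZr -inner_conj mulrC. Qed.

Definition Lvac (H : preHilbertType C) : 'L(H) :=
  @mkL C H H (fun x => ⟨Ω, x⟩ *: Ω) (fun x => ⟨Ω, x⟩ *: Ω) (@Lvac_subproof H).

Definition Lvacp (H : preHilbertType C) : 'L(H) := Lid H - Lvac H.

(* T_γ, as the sum of its blocks with respect to H = CΩ ⊕ Ω^⊥; the conjugate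
   comes from (γ t')^* = γ^* (t')^*. *)
Definition twist (H : preHilbertType C) (γ : C) (T : 'L(H)) : 'L(H) :=
    `|γ| *: (Lvac H ∘ T ∘ Lvac H) + γ^* *: (Lvac H ∘ T ∘ Lvacp H)
  + γ *: (Lvacp H ∘ T ∘ Lvac H) + `|γ| *: (Lvacp H ∘ T ∘ Lvacp H).

Definition lift_right (H : bool -> preHilbertType C) (l : bool) (γ : C)
    (T : 'L(H l)) : 'L(alt_space H None) :=
  (Lsplit H l)^† ∘ (Ltens T (Lvac _) + Ltens (twist γ T) (Lvacp _)) ∘ Lsplit H l.

Definition lift_left (H : bool -> preHilbertType C) (l : bool) (γ : C)
    (T : 'L(H l)) : 'L(alt_space H None) :=
  (Lrev H)^† ∘ lift_right γ T ∘ Lrev H.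

Inductive direction := rightwards | leftwards.

Definition lift (s : direction) := if s is rightwards then lift_right else lift_left.

Definition lambda_lift (s : direction) (γ : C) (H1 H2 : preHilbertType C)
  (T : 'L(H1)) : 'L(H1 ∗ H2) := @lift s (pair_family H1 H2) false γ T.

Definition rho_lift (s : direction) (δ : C) (H1 H2 : preHilbertType C)
  (S : 'L(H2)) : 'L(H1 ∗ H2) := @lift s (pair_family H1 H2) true δ S.

End Lifts.

(** * Two-faced universal products of states *)

Section Products.
Variable C : numClosedFieldType.

Definition two_faced_product := forall A B : twoFaced C,
  (A -> C) -> (B -> C) -> (A ⊔ B -> C).

Definition represents (A : starAlgType C) (H : preHilbertType C)
    (pi : A -> 'L(H)) (phi : A -> C) : Prop :=
  star_hom pi /\ forall a, phi a = ⟨Ω, pi a Ω⟩.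

(* Face i carries the lifts given by [s i], [γ i] and [δ i]; the default value
   [fun=> 0] is irrelevant, since every state is represented by a vector state
   and the product does not depend on the choices. *)
Definition lift_product (s : bool -> direction) (γ δ : bool -> C) :
    two_faced_product := fun A B phi psi =>
  xget (fun=> 0) [set omega : A ⊔ B -> C |
    exists (H G : preHilbertType C) (pi : A -> 'L(H)) (sigma : B -> 'L(G))
           (Pi : A ⊔ B -> 'L(H ∗ G)),
      [/\ represents pi phi, represents sigma psi,
          star_hom Pi,
          forall i, (forall a : face A i, Pi (coprodl B (face_incl a)) =
                      lambda_lift (s i) (γ i) G (pi (face_incl a))) /\
                    (forall b : face B i, Pi (coprodr A (face_incl b)) =
                      rho_lift (s i) (δ i) H (sigma (face_incl b))) &
          omega = fun c => ⟨Ω, Pi c Ω⟩]].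

Definition F (s1 s2 : direction) (γ1 δ1 γ2 δ2 : C) : two_faced_product :=
  lift_product (fun i => if i then s2 else s1) (fun i => if i then γ2 else γ1)
               (fun i => if i then δ2 else δ1).

Definition coincide (P Q : two_faced_product) : Prop :=
  forall (A B : twoFaced C) (phi : A -> C) (psi : B -> C),
    state phi -> state psi -> P A B phi psi =1 Q A B phi psi.

Definition admissible (γ δ : C) : Prop :=
  (`|γ| = 1 /\ `|δ| = 1) \/ (γ = 0 /\ δ = 0).

Inductive listed :=
  | SameSide of C & C
  | OppositeSides of C & C
  | FreeBoolean
  | BooleanFree
  | BooleanBoolean.

Definition listed_valid (e : listed) : Prop :=
  match e with
  | SameSide ζ θ | OppositeSides ζ θ => `|ζ| = 1 /\ `|θ| = 1
  | _ => True
  end.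

Definition listed_product (e : listed) : two_faced_product :=
  match e with
  | SameSide ζ θ => F rightwards rightwards ζ θ 1 1
  | OppositeSides ζ θ => F rightwards leftwards ζ θ 1 1
  | FreeBoolean => F rightwards rightwards 1 1 0 0
  | BooleanFree => F rightwards rightwards 0 0 1 1
  | BooleanBoolean => F rightwards rightwards 0 0 0 0
  end.

End Products.

(* Main.v *)
From HB Require Import structures.
From mathcomp Require Import all_boot all_order all_algebra.
From mathcomp Require Import boolp classical_sets.
From mathcomp Require Import complex reals.
Require Import Defs.

Set Implicit Arguments.
Unset Strict Implicit.
Unset Printing Implicit Defensive.

Import Order.TTheory GRing.Theory Num.Theory.
Local Open Scope ring_scope.

(* A unitary of H_1 * H_2 that fixes the vacuum and intertwines two families of
   lifts, on all pairs of spaces, shows that the products they define are equal.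
   Three such unitaries give all the coincidences: the word reversal R exchanges
   the two directions on both faces at once; the identity serves for γ = 0, where
   lifting on either side gives the same operator, supported on CΩ ⊕ H_l; and the
   diagonal unitary that multiplies a word by ε for each transition from a letter
   of H_1 to one of H_2 and by η for each transition back multiplies the
   parameters (γ, δ) of a right lift by (ε^*, η^* ) and those of a left lift by
   (η^*, ε^* ).

   The listed products are told apart by a vector state on L(C^2) ⊔ L(C^2) in
   which one operator of each face maps Ω to the same unit vector e orthogonal
   to Ω. The lift of such an operator on side l maps Ω to the one-letter word e,
   and a one-letter word of the other side to γ times a two-letter word. The
   inner products of these vectors are moments, and equal the products γ^* γ' or
   0, according to whether the letters of the two words come in the same order. *)

(** * The unitaries U and R and the lifts on elementary tensors *)

Lemma LcompE (C : numClosedFieldType) (H K M : preHilbertType C) (S : Ladj K M)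
    (T : Ladj H K) x : (S ∘ T) x = S (T x).
Proof. by []. Qed.

Lemma LadjZ (C : numClosedFieldType) (H K : preHilbertType C) (T : Ladj H K) a x :
  T (a *: x) = a *: T x.
Proof. exact: linearZ. Qed.

Lemma LconjE (C : numClosedFieldType) (H K : preHilbertType C) (W : Ladj H K)
    (T : 'L(K)) x :
  (W^† ∘ T ∘ W) x = W^† (T (W x)).
Proof. by []. Qed.

Lemma Lsmul (C : numClosedFieldType) (H : preHilbertType C) (S T : 'L(H)) :
  S ⋅ T = S ∘ T.
Proof. by []. Qed.

(** * Equality of operators, tested on elementary tensors *)

Section Density.
Variable C : numClosedFieldType.

Lemma Ladj_kspace_ext (X : Type) (k : kernel C X) (K : preHilbertType C)
    (S T : Ladj (kspace k) K) :
  (forall x, S (kgen k x) = T (kgen k x)) -> S = T.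
Proof.
move=> e; apply: Ladj_ext => f; rewrite (kspaceE f) !linear_sum.
by apply: eq_bigr => p _; rewrite !linearZ /= e.
Qed.

Lemma Ladj_elem_ext (H : bool -> preHilbertType C) o (K : preHilbertType C)
    (S T : Ladj (alt_space H o) K) :
  (forall w, word_pred o w -> S (elem o w) = T (elem o w)) -> S = T.
Proof.
by move=> e; apply: Ladj_kspace_ext => w; rewrite -elemE e //; exact: valP.
Qed.

Lemma Ladj_tens_ext (H : bool -> preHilbertType C) o (K M : preHilbertType C)
    (S T : Ladj (K ⊗ alt_space H o)%type M) :
  (forall x w, word_pred o w -> S (x ⊗ elem o w) = T (x ⊗ elem o w)) -> S = T.
Proof.
move=> e; apply: Ladj_kspace_ext => -[x f].
rewrite -[kgen _ _]/(x ⊗ f) (kspaceE f) !linear_sum; apply: eq_bigr => p _.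
by rewrite !linearZ /= -elemE e //; exact: valP.
Qed.

End Density.

(** * Unitarity of U and V *)

Section Split.
Variables (C : numClosedFieldType) (H : bool -> preHilbertType C).
Implicit Types (l : bool) (u v w : seq (letter H)).

Local Notation elemN := (elem (H:=H) None).

(* These vectors span H_1 * H_2, and a right lift on side l acts on them through
   the factor x alone. *)
Definition prepend l (w : seq (letter H)) (x : H l) : alt_space H None :=
  (Lsplit H l)^† (x ⊗ elem (Some l) w).

Lemma LsplitE l w : word_pred None w ->
  Lsplit H l (elemN w) = match w with
  | [::] => Ω ⊗ Ω
  | a :: w' => letter_case (Ω ⊗ elem (Some l) (a :: w'))
                          (fun x : H l => x ⊗ elem (Some l) w') a
  end.
Proof.
move=> wp; rewrite -[w]/(val (exist (word_pred None) w wp : word H None)) elemE.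
by rewrite kopE.
Qed.

Lemma word_pred_Some_cons l i (x : H i) w : i != l ->
  word_pred None (mkletter x :: w) -> word_pred (Some l) (mkletter x :: w).
Proof.
move=> il /and3P[a c _]; rewrite /word_pred a c /=.
by apply: contra il => /eqP[->].
Qed.

Lemma word_pred_tag l a w : word_pred (Some l) (a :: w) -> tag a = ~~ l.
Proof.
case/and3P => _ _ /=; rewrite -[_ == _ :> option bool]/(tag a == l).
by case: (tag a) l => -[].
Qed.

Lemma Lsplit_same l (x : H l) w : word_pred None (mkletter x :: w) ->
  Lsplit H l (elemN (mkletter x :: w)) = x ⊗ elem (Some l) w.
Proof. by move=> xw; rewrite LsplitE // letter_caseE. Qed.

Lemma Lsplit_other l w : word_pred (Some l) w ->
  Lsplit H l (elemN w) = Ω ⊗ elem (Some l) w.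
Proof.
move=> wp; rewrite LsplitE; last exact: word_pred_None wp.
case: w wp => [|a w] wp; first by rewrite elem_nil.
by rewrite letter_case_dflt // (word_pred_tag wp); case: (l).
Qed.

(** The empty word falls under [WordOther], so that Ω is treated like any word of H(l). *)
Variant word_split_spec l : seq (letter H) -> Prop :=
  | WordSame x w : ⟨Ω, x⟩ = 0 -> word_pred (Some l) w ->
      word_split_spec l (mkletter (x : H l) :: w)
  | WordOther w : word_pred (Some l) w -> word_split_spec l w.

Lemma word_splitP l w : word_pred None w -> word_split_spec l w.
Proof.
case: w => [|[i x] w] wp; first by constructor.
case: (eqVneq i l) => [il|il]; last by constructor; exact: word_pred_Some_cons.
subst i; move: (wp); rewrite word_pred_cons => /andP[/eqP x0 w'].
by constructor.
Qed.

(** A word with first letter x in H_l is orthogonal to every word of H(l), and so are their images,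
    because x is orthogonal to Ω in the first factor. *)
Lemma inner_Lsplit l (u v : seq (letter H)) :
  word_pred None u -> word_pred None v ->
  ⟨Lsplit H l (elemN u), Lsplit H l (elemN v)⟩ = ⟨elemN u, elemN v⟩.
Proof.
have same (x : H l) w : ⟨Ω, x⟩ = 0 -> word_pred (Some l) w ->
    word_pred None (mkletter x :: w).
  by move=> x0 wp; rewrite word_pred_cons x0 eqxx.
have mixed (x : H l) w w' : ⟨Ω, x⟩ = 0 ->
    word_pred (Some l) w' -> word_fun (mkletter x :: w) w' = 0.
  case: w' => [|a w'] // x0 wp' /=; rewrite letter_fun_neq ?mul0r //=.
  by rewrite (word_pred_tag wp'); case: (l).
move=> up vp; case: (word_splitP l up) => [x u' x0 up'|u' up'];
  case: (word_splitP l vp) => [y v' y0 vp'|v' vp'].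
- rewrite !Lsplit_same ?same // inner_tens !inner_elem ?same //=.
  by rewrite letter_funE.
- rewrite Lsplit_same ?same // Lsplit_other // inner_tens.
  rewrite [⟨x, _⟩]inner_conj x0 rmorph0 mul0r inner_elem ?same ?mixed //.
  exact: word_pred_None vp'.
- rewrite Lsplit_same ?same // Lsplit_other // inner_tens.
  rewrite y0 mul0r [RHS]inner_conj inner_elem ?same ?mixed ?rmorph0 //.
  exact: word_pred_None up'.
- rewrite !Lsplit_other // inner_tens inner_vac mul1r !inner_elem //.
    exact: word_pred_None up'.
  exact: word_pred_None vp'.
Qed.

Lemma elem_inj o (f g : alt_space H o) :
  (forall w, word_pred o w -> ⟨elem o w, f⟩ = ⟨elem o w, g⟩) -> f = g.
Proof.
move=> e; apply/val_inj/funext => w /=.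
by rewrite -!inner_genl -elemE e //; exact: valP.
Qed.

Lemma LsplitK l : (Lsplit H l)^† ∘ Lsplit H l = Lid _.
Proof.
apply: Ladj_elem_ext => w wp; apply: elem_inj => v vp.
by rewrite LcompE dagPr inner_Lsplit.
Qed.

Lemma LsplitKx l x : (Lsplit H l)^† (Lsplit H l x) = x.
Proof. exact: (congr1 (fun T : 'L(alt_space H None) => T x) (LsplitK l)). Qed.

Lemma tens_center l (x : H l) (y : alt_space H (Some l)) :
  x ⊗ y = ⟨Ω, x⟩ *: (Ω ⊗ y) + center x ⊗ y.
Proof.
have := tens_linearl y ⟨Ω, x⟩ Ω (center x); rewrite /= => <-.
by rewrite /center addrC subrK.
Qed.

Lemma center_vac l (x : H l) : ⟨Ω, center x⟩ = 0.
Proof. by rewrite innerBr innerZr inner_vac mulr1 subrr. Qed.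

(** Surjectivity: decomposing x into its component along Ω and [center x] gives a preimage of x ⊗
    w. *)
Lemma Lsplit_dagK l : Lsplit H l ∘ (Lsplit H l)^† = Lid _.
Proof.
apply: Ladj_tens_ext => x w wp; rewrite LcompE.
suff [z ->] : exists z, x ⊗ elem (Some l) w = Lsplit H l z by rewrite LsplitKx.
exists (⟨Ω, x⟩ *: elemN w + elemN (mkletter (center x) :: w)).
rewrite Ladj_linear Lsplit_other // Lsplit_same; first exact: tens_center.
by rewrite word_pred_cons center_vac eqxx.
Qed.

Lemma Lsplit_dagKx l y : Lsplit H l ((Lsplit H l)^† y) = y.
Proof. exact: (congr1 (fun T : 'L(_) => T y) (Lsplit_dagK l)). Qed.

(** [Lsplit H l] is isometric, so its adjoint is onto and the images of the elementary tensors
    span. *)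
Lemma prepend_ext l (K : preHilbertType C) (S T : Ladj (alt_space H None) K) :
  (forall (x : H l) w, word_pred (Some l) w ->
    S (prepend w x) = T (prepend w x)) -> S = T.
Proof.
move=> e; apply: Ladj_ext => z; rewrite -(LsplitKx l z).
suff E : S ∘ (Lsplit H l)^† = T ∘ (Lsplit H l)^†.
  exact: (congr1 (fun V : Ladj _ K => V (Lsplit H l z)) E).
by apply: Ladj_tens_ext => x w wp; exact: e.
Qed.

Lemma prepend_linear l w : linear (@prepend l w).
Proof.
move=> a x y; rewrite /prepend.
by rewrite (tens_linearl (elem (Some l) w) a x y : _ = _) Ladj_linear.
Qed.
HB.instance Definition _ l w := GRing.isLinear.Build C (H l) (alt_space H None) _
  (@prepend l w) (prepend_linear w).

Lemma prepend_other l w : word_pred (Some l) w -> prepend w (Ω : H l) = elemN w.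
Proof. by move=> wp; rewrite /prepend -Lsplit_other // LsplitKx. Qed.

Lemma prepend_same l (x : H l) w : ⟨Ω, x⟩ = 0 -> word_pred (Some l) w ->
  prepend w x = elemN (mkletter x :: w).
Proof.
move=> x0 wp; rewrite /prepend -Lsplit_same ?LsplitKx //.
by rewrite word_pred_cons x0 eqxx.
Qed.

Lemma prependZ l w a (x : H l) : prepend w (a *: x) = a *: prepend w x.
Proof. exact: linearZ. Qed.

End Split.

(** * T_γ as a conjugate of T *)

Section Twist.
Variables (C : numClosedFieldType).
Implicit Types H K : preHilbertType C.

Lemma unit_conj (γ : C) : `|γ| = 1 -> γ * γ^* = 1.
Proof. by move=> g1; rewrite -normCK g1 expr1n. Qed.

Lemma dag0 H : (0 : 'L(H))^† = 0.
Proof.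
by apply: Ladj_ext; apply: dag_uniq => x y; rewrite /= inner0l inner0r.
Qed.

Lemma Lvac_dag H : (Lvac H)^† = Lvac H.
Proof. by apply: Ladj_ext; apply: dag_uniq; exact: Lvac_subproof. Qed.

Lemma Lid_dag H : (Lid H)^† = Lid H.
Proof. by apply: Ladj_ext; apply: dag_uniq. Qed.

Lemma Lvacp_dag H : (Lvacp H)^† = Lvacp H.
Proof. by rewrite /Lvacp -scaleN1r dagD dagZ rmorphN1 Lvac_dag Lid_dag. Qed.

(** For |γ| = 1 this is the unitary diag(1, γ) on CΩ ⊕ Ω^⊥. *)
Definition Lphase H (γ : C) : 'L(H) := Lvac H + γ *: Lvacp H.

Lemma LvacE H (x : H) : Lvac H x = ⟨Ω, x⟩ *: Ω. Proof. by []. Qed.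

Lemma Lvac_vac H : Lvac H Ω = Ω.
Proof. by rewrite /= inner_vac scale1r. Qed.

Lemma Lvac_idem H : Lvac H ∘ Lvac H = Lvac H.
Proof. by apply: Ladj_ext => x /=; rewrite innerZr inner_vac mulr1. Qed.

Lemma Lvac_vacp H : Lvac H ∘ Lvacp H = 0.
Proof.
rewrite /Lvacp LcompDr -scaleN1r LcompZr Lvac_idem scaleN1r.
by have -> : Lvac H ∘ Lid H = Lvac H; [exact: Ladj_ext|rewrite subrr].
Qed.

Lemma Lvacp_vac H : Lvacp H ∘ Lvac H = 0.
Proof. by rewrite -Lvac_dag -Lvacp_dag -dagM Lvac_vacp dag0. Qed.

Lemma Lvacp_idem H : Lvacp H ∘ Lvacp H = Lvacp H.
Proof.
rewrite {1}/Lvacp LcompDl -scaleN1r LcompZl Lvac_vacp scaler0 addr0.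
exact: Ladj_ext.
Qed.

Lemma Lphase_dag H (γ : C) : (Lphase H γ)^† = Lphase H γ^*.
Proof. by rewrite dagD dagZ Lvac_dag Lvacp_dag. Qed.

Lemma LphaseM H (γ δ : C) : Lphase H γ ∘ Lphase H δ = Lphase H (γ * δ).
Proof.
rewrite /Lphase; move: (Lvac_idem H) (Lvacp_idem H) (Lvac_vacp H) (Lvacp_vac H).
move: (Lvac H) (Lvacp H) => P Q PP QQ PQ QP.
rewrite !(LcompDl, LcompDr, LcompZl, LcompZr) PP QQ PQ QP.
by rewrite !scaler0 addr0 add0r scalerA.
Qed.

Lemma Lphase1 H : Lphase H 1 = Lid H.
Proof. by rewrite /Lphase scale1r addrC subrK. Qed.

(** Conjugation by diag(1, γ) multiplies the off-diagonal blocks by γ^* and γ, and the diagonal ones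
    by 1 = γ γ^* = |γ|. *)
Lemma twist_unit H (γ : C) (T : 'L(H)) : `|γ| = 1 ->
  twist γ T = Lphase H γ ∘ T ∘ (Lphase H γ)^†.
Proof.
move=> g1; rewrite Lphase_dag /twist /Lphase g1; move: (Lvac H) (Lvacp H) => P Q.
rewrite !(LcompDl, LcompDr, LcompZl, LcompZr) !scalerA.
by rewrite unit_conj // !scale1r !addrA; congr (_ + _); rewrite addrAC.
Qed.

Lemma twist0 H (T : 'L(H)) : twist 0 T = 0.
Proof. by rewrite /twist normr0 conjC0 !scale0r !addr0. Qed.

Lemma twist1 H (T : 'L(H)) : twist 1 T = T.
Proof. by rewrite twist_unit ?normr1 // Lphase1 Lid_dag; exact: Ladj_ext. Qed.

Definition phase_or_zero (γ : C) := γ = 0 \/ `|γ| = 1.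

Lemma twist_star_hom H (γ : C) : phase_or_zero γ -> star_hom (@twist C H γ).
Proof.
case=> [->|g1].
  split=> [a S T|S T|T]; rewrite !twist0 ?scaler0 ?addr0 //.
    by rewrite -(scale0r 0) smulZl !scale0r.
  by rewrite -(scale0r 0) starZ rmorph0 !scale0r.
split=> [a S T|S T|T]; rewrite !twist_unit //.
- by rewrite LcompDr LcompZr LcompDl LcompZl.
- have DK : (Lphase H γ)^† ∘ Lphase H γ = Lid H.
    by rewrite Lphase_dag LphaseM mulrC unit_conj // Lphase1.
  rewrite /smul /= -![in RHS](LcompA, smulA).
  rewrite -!LcompA; congr (_ ∘ (_ ∘ _)).
  by rewrite [RHS]LcompA DK; exact: Ladj_ext.
- by rewrite /star /= !dagM dagK LcompA.
Qed.

End Twist.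

(** * The lifts as star-homomorphisms *)

Section LiftHom.
Variables (C : numClosedFieldType) (H : bool -> preHilbertType C).
Implicit Types (l : bool) (w : seq (letter H)).

Lemma Ltens_dag (K M : preHilbertType C) (T : 'L(K)) (S : 'L(M)) :
  (Ltens T S)^† = Ltens T^† S^†.
Proof.
apply: Ladj_kspace_ext => -[x y]; apply: (@inner_inj C) => z.
rewrite -[kgen _ _]/(x ⊗ y) (kspaceE z) !inner_suml; apply: eq_bigr => -[c [x' y']] _.
by rewrite !innerZl -[kgen _ _]/(x' ⊗ y') dagPr !LtensE !inner_tens !dagPr.
Qed.

Lemma tensZr (K M : preHilbertType C) (x : K) a (y : M) :
  x ⊗ (a *: y) = a *: (x ⊗ y).
Proof. exact: linearZ. Qed.

Definition lift_mid l (γ : C) (T : 'L(H l)) : 'L((H l ⊗ alt_space H (Some l))%type) :=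
  Ltens T (Lvac _) + Ltens (twist γ T) (Lvacp _).

(** P_Ω fixes w if w is empty and kills it otherwise; since T_1 = T, a change of the parameter of
    [twist] covers both cases. *)
Lemma lift_midE l (γ : C) (T : 'L(H l)) (x : H l) w : word_pred (Some l) w ->
  lift_mid γ T (x ⊗ elem (Some l) w) =
  twist (if nilp w then 1 else γ) T x ⊗ elem (Some l) w.
Proof.
move=> wp; rewrite /lift_mid LaddE !LtensE.
have E : Lvac _ (elem (Some l) w) = (nilp w)%:R *: elem (Some l) w.
  rewrite LvacE -{1}elem_nil inner_elem //.
  by case: w wp => [|a w] wp; rewrite /= ?elem_nil // !scale0r.
have -> : Lvacp _ (elem (Some l) w) = (~~ nilp w)%:R *: elem (Some l) w.
  rewrite -[LHS]/(elem (Some l) w - Lvac _ (elem (Some l) w)) E.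
  by case: nilp; rewrite ?scale1r ?subrr ?scale0r ?subr0 ?scale1r.
rewrite E.
by case: nilp; rewrite ?twist1 !tensZr !scale1r !scale0r ?addr0 ?add0r.
Qed.

(** Together with [prepend_ext], this is how right lifts are computed below. *)
Lemma lift_right_prepend l (γ : C) (T : 'L(H l)) (x : H l) w :
  word_pred (Some l) w ->
  lift_right γ T (prepend w x) = prepend w (twist (if nilp w then 1 else γ) T x).
Proof.
move=> wp; rewrite /lift_right !LcompE Lsplit_dagKx -/(lift_mid γ T).
by rewrite lift_midE.
Qed.

Lemma lift_right_dag l (γ : C) (T : 'L(H l)) : phase_or_zero γ ->
  (lift_right γ T)^† = lift_right γ (T^†).
Proof.
move=> gP; apply: Ladj_ext; apply: dag_uniq => x y.
have E : (lift_mid γ T)^† = lift_mid γ (T^†).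
  rewrite /lift_mid dagD !Ltens_dag Lvac_dag Lvacp_dag; congr (_ + Ltens _ _).
  by case: (twist_star_hom (H l) gP) => _ _ ->.
rewrite /lift_right !LcompE -/(lift_mid γ T) -/(lift_mid γ (T^†)) -E.
by rewrite dagPr inner_conj dagPr -inner_conj dagP.
Qed.

Lemma phase_or_zero_if (b : bool) (γ : C) : phase_or_zero γ ->
  phase_or_zero (if b then 1 else γ).
Proof. by case: b => // _; right; rewrite normr1. Qed.

Lemma lift_right_star_hom l (γ : C) : phase_or_zero γ ->
  star_hom (@lift_right C H l γ).
Proof.
move=> gP; split=> [a S T|S T|T].
- apply: (@prepend_ext _ _ l) => x w wp; rewrite LaddE LscaleE !lift_right_prepend //.
  case: (twist_star_hom (H l) (phase_or_zero_if (nilp w) gP)) => -> _ _.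
  by rewrite LaddE LscaleE prepend_linear.
- apply: (@prepend_ext _ _ l) => x w wp.
  rewrite !Lsmul (LcompE (lift_right γ S)) !lift_right_prepend //.
  case: (twist_star_hom (H l) (phase_or_zero_if (nilp w) gP)) => _ twM _.
  by rewrite -Lsmul twM Lsmul LcompE.
- by rewrite /star /= lift_right_dag.
Qed.

Lemma Lrev_elem w : word_pred None w -> Lrev H (elem None w) = elem None (rev w).
Proof.
move=> wp; rewrite -[w]/(val (exist (word_pred None) w wp : word H None)) elemE.
by rewrite kopE.
Qed.

Lemma Lrev_dag : (Lrev H)^† = Lrev H.
Proof.
apply: Ladj_elem_ext => w wp; apply: elem_inj => v vp.
rewrite dagPr !Lrev_elem // !inner_elem ?word_pred_rev //.
by rewrite -word_fun_rev revK.
Qed.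

Lemma LrevK : Lrev H ∘ Lrev H = Lid _.
Proof.
by apply: Ladj_elem_ext => w wp; rewrite LcompE !Lrev_elem ?word_pred_rev // revK.
Qed.

(** W W^† = 1 cancels between the factors of a product. Used with W = R for left lifts, and to
    transport representations of A ⊔ B. *)
Lemma conj_star_hom (A : starAlgType C) (K : preHilbertType C) (W : 'L(K))
    (f : A -> 'L(K)) :
  W ∘ W^† = Lid K -> star_hom f -> star_hom (fun a => W^† ∘ f a ∘ W).
Proof.
move=> WK [fl fm fs]; split=> [c a b|a b|a].
- by rewrite fl LcompDr LcompZr LcompDl LcompZl.
- rewrite fm /smul /= -!LcompA; congr (_ ∘ (_ ∘ _)).
  by rewrite [RHS]LcompA WK; exact: Ladj_ext.
- by rewrite fs /star /= !dagM dagK LcompA.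
Qed.

Lemma lift_star_hom s l (γ : C) : phase_or_zero γ -> star_hom (@lift C s H l γ).
Proof.
case: s => gP; first exact: lift_right_star_hom.
apply: conj_star_hom; last exact: lift_right_star_hom.
by rewrite Lrev_dag LrevK.
Qed.

End LiftHom.

(** * Coincidences between the products *)

Section Transport.
Variable C : numClosedFieldType.
Implicit Types (s : bool -> direction) (γ δ : bool -> C).

(** The parameter of the lift on side l in face i: λ acts on side [false], ρ on side [true]. *)
Definition gain γ δ (i l : bool) : C := if l then δ i else γ i.

(** One W serves both faces and both sides, so it conjugates the whole representation of A ⊔ B. *)
Definition equivalent_lifts s γ δ s' γ' δ' : Prop :=
  forall H : bool -> preHilbertType C, exists W : 'L(alt_space H None),
  [/\ W^† ∘ W = Lid _, W ∘ W^† = Lid _, W Ω = Ω &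
    forall i l (T : 'L(H l)), lift (s' i) (gain γ' δ' i l) T =
      W^† ∘ lift (s i) (gain γ δ i l) T ∘ W].

Lemma equivalent_lifts_sym s γ δ s' γ' δ' :
  equivalent_lifts s γ δ s' γ' δ' -> equivalent_lifts s' γ' δ' s γ δ.
Proof.
move=> + H => /(_ H)[W [WV VW W1 WE]]; exists W^†; split; rewrite ?dagK //.
  by rewrite -[in LHS]W1 -LcompE WV.
move=> i l T; rewrite WE; apply: Ladj_ext => x.
have VWx y : W (W^† y) = y by rewrite -LcompE VW.
by rewrite !LcompE !VWx.
Qed.

(** The set from which [lift_product] chooses its value by [xget]. *)
Definition lift_models s γ δ (A B : twoFaced C) (phi : A -> C) (psi : B -> C) :
    set (A ⊔ B -> C) := [set omega |
  exists (H G : preHilbertType C) (pi : A -> 'L(H)) (sigma : B -> 'L(G))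
         (Pi : A ⊔ B -> 'L(H ∗ G)),
    [/\ represents pi phi, represents sigma psi,
        star_hom Pi,
        forall i, (forall a : face A i, Pi (coprodl B (face_incl a)) =
                    lambda_lift (s i) (γ i) G (pi (face_incl a))) /\
                  (forall b : face B i, Pi (coprodr A (face_incl b)) =
                    rho_lift (s i) (δ i) H (sigma (face_incl b))) &
        omega = fun c => ⟨Ω, Pi c Ω⟩]].

Lemma lift_models_sub s γ δ s' γ' δ' : equivalent_lifts s γ δ s' γ' δ' ->
  forall (A B : twoFaced C) (phi : A -> C) (psi : B -> C),
  (lift_models s γ δ phi psi `<=` lift_models s' γ' δ' phi psi)%classic.
Proof.
move=> eqv A B phi psi omega [H [G [pi [sigma [Pi [piP sigmaP Pih PiE ->]]]]]].
have [W [WV VW W1 WE]] := eqv (pair_family H G).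
exists H, G, pi, sigma, (fun c => W^† ∘ Pi c ∘ W); split => //.
- exact: conj_star_hom.
- move=> i; case: (PiE i) => PiA PiB; split=> [a|b].
    by rewrite PiA; exact/esym/(WE i false).
  by rewrite PiB; exact/esym/(WE i true).
- by apply/funext => c; rewrite !LcompE dagPr W1.
Qed.

(** Both products choose from the same set with the same default, hence agree on all functionals,
    states or not. *)
Lemma lift_product_eq s γ δ s' γ' δ' : equivalent_lifts s γ δ s' γ' δ' ->
  lift_product s γ δ = lift_product s' γ' δ'.
Proof.
move=> eqv; apply: functional_extensionality_dep => A.
apply: functional_extensionality_dep => B.
apply/funext => phi; apply/funext => psi; congr xget.
apply/seteqP; split; first exact: (@lift_models_sub s γ δ s' γ' δ').
exact/(@lift_models_sub s' γ' δ' s γ δ)/equivalent_lifts_sym.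
Qed.

End Transport.

(** * The diagonal unitary that counts transitions *)

Section Phases.
Variables (C : numClosedFieldType) (H : bool -> preHilbertType C).
Implicit Types (e : bool -> C) (l : bool) (u v w : seq (letter H)).

(** A letter contributes [e] of its side if another letter follows it; in an alternating word this
    is the phase of the transition to the other side. *)
Fixpoint tag_phase e (t : seq bool) : C :=
  if t is a :: t' then (if nilp t' then 1 else e a) * tag_phase e t' else 1.

Lemma tag_phase_rcons e t a :
  tag_phase e (rcons t a) = (if nilp t then 1 else e (last a t)) * tag_phase e t.
Proof.
elim: t => [|b t IH] //=; rewrite IH; case: t {IH} => [|c t] //=.
by rewrite mulrCA.
Qed.

(** Reversal turns a transition from i to j into one from j to i, and j = [~~ i] in an alternating
    word. *)
Lemma tag_phase_rev e t : sorted (fun i j => i != j) t ->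
  tag_phase e (rev t) = tag_phase (e \o negb) t.
Proof.
elim: t => [|a t IH] // at_; rewrite rev_cons tag_phase_rcons IH; last first.
  exact: path_sorted at_.
case: t at_ {IH} => [|b t] //= /andP[ab _].
rewrite rev_cons last_rcons /nilp size_rcons /=.
by congr (e _ * _); case: a b ab => -[].
Qed.

Lemma tag_phase_conj e t : (tag_phase e t)^* = tag_phase (fun l => (e l)^*) t.
Proof.
elim: t => [|a t IH] /=; first by rewrite rmorph1.
by rewrite rmorphM /= IH; case: nilp; rewrite ?rmorph1.
Qed.

Lemma tag_phase_unit e t : (forall l, `|e l| = 1) ->
  tag_phase e t * (tag_phase e t)^* = 1.
Proof.
move=> e1; apply: unit_conj; elim: t => [|a t IH] /=; first by rewrite normr1.
by rewrite normrM IH mulr1; case: nilp; rewrite ?normr1.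
Qed.

Definition word_phase e w := tag_phase e [seq tag a | a <- w].

Lemma word_fun_tag u v :
  word_fun u v != 0 -> [seq tag a | a <- u] = [seq tag a | a <- v].
Proof.
elim: u v => [|a u IH] [|b v] //=; rewrite ?eqxx //.
rewrite mulf_eq0 negb_or => /andP[ab uv]; rewrite (IH _ uv); congr (_ :: _).
by apply/eqP; apply: contraNT ab => ab; rewrite letter_fun_neq.
Qed.

(** Words with nonzero inner product visit the same sides in the same order. Hence the diagonal
    operator has an adjoint, with conjugate entries. *)
Lemma word_phase_fun e u v :
  word_phase e u * word_fun u v = word_phase e v * word_fun u v.
Proof.
have [->|/word_fun_tag uv] := eqVneq (word_fun u v) 0; first by rewrite !mulr0.
by rewrite /word_phase uv.
Qed.

Fact Lwphase_subproof e : kadjointable (word_kernel H None)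
  (fun w : word H None => word_phase e (val w) *: kgen (word_kernel H None) w).
Proof.
apply: kadjointable_gen => v.
exists ((word_phase e (val v))^* *: kgen (word_kernel H None) v) => w.
rewrite -inner_genl innerZl innerZr inner_genl /=.
by rewrite !tag_phase_conj; exact: word_phase_fun.
Qed.

Definition Lwphase e : 'L(alt_space H None) := kop (Lwphase_subproof e).

Lemma Lwphase_elem e w : word_pred None w ->
  Lwphase e (elem None w) = word_phase e w *: elem None w.
Proof.
move=> wp; rewrite -[w]/(val (exist (word_pred None) w wp : word H None)) elemE.
by rewrite kopE.
Qed.

Lemma Lwphase_dag e : (Lwphase e)^† = Lwphase (fun l => (e l)^*).
Proof.
apply: Ladj_elem_ext => w wp; apply: elem_inj => v vp.
rewrite dagPr !Lwphase_elem // innerZl innerZr inner_elem //.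
by rewrite /word_phase tag_phase_conj; exact: word_phase_fun.
Qed.

Lemma Lwphase_dagK e : (forall l, `|e l| = 1) ->
  (Lwphase e)^† ∘ Lwphase e = Lid _.
Proof.
move=> e1; apply: Ladj_elem_ext => w wp.
rewrite LcompE Lwphase_dag Lwphase_elem // LadjZ Lwphase_elem // scalerA.
by rewrite /word_phase -tag_phase_conj tag_phase_unit // scale1r.
Qed.

Lemma Lwphase_Kdag e : (forall l, `|e l| = 1) ->
  Lwphase e ∘ (Lwphase e)^† = Lid _.
Proof.
move=> e1; have := @Lwphase_dagK (fun l => (e l)^*).
rewrite -Lwphase_dag dagK; apply => l.
by rewrite norm_conjC.
Qed.

Lemma prependE l w (x : H l) : word_pred (Some l) w ->
  prepend w x = ⟨Ω, x⟩ *: elem None w + elem None (mkletter (center x) :: w).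
Proof.
move=> wp; rewrite -(prepend_other wp) -prepend_same ?center_vac //.
by rewrite -prepend_linear /center addrC subrK.
Qed.

Lemma LphaseE (K : preHilbertType C) (a : C) (x : K) :
  Lphase K a x = ⟨Ω, x⟩ *: Ω + a *: (x - ⟨Ω, x⟩ *: Ω).
Proof. by []. Qed.

(** Prepending Ω adds no letter, and prepending a vector orthogonal to Ω adds a transition leaving
    side l, unless w is empty. *)
Lemma Lwphase_prepend e l w (x : H l) : word_pred (Some l) w ->
  Lwphase e (prepend w x) =
  word_phase e w *: prepend w (Lphase (H l) (if nilp w then 1 else e l) x).
Proof.
move=> wp; rewrite LphaseE -/(center x) prepend_linear prependZ.
rewrite prepend_other // (prepend_same (center_vac x) wp) prependE //.
have cp : word_pred None (mkletter (center x) :: w).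
  by rewrite word_pred_cons center_vac eqxx.
rewrite Ladj_linear !Lwphase_elem //; last exact: word_pred_None wp.
rewrite scalerDr !scalerA (mulrC (word_phase e w)); congr (_ + _ *: _).
by rewrite mulrC; case: (w).
Qed.

Lemma twist_phase (K : preHilbertType C) (γ ε : C) (T : 'L(K)) :
  phase_or_zero γ -> `|ε| = 1 ->
  (Lphase K ε)^† ∘ twist γ T ∘ Lphase K ε = twist (γ * ε^*) T.
Proof.
move=> [->|g1] e1.
  rewrite mul0r !twist0; apply: Ladj_ext => x; rewrite !LcompE.
  by apply: inner_inj => z; rewrite dagPr /= !inner0r.
rewrite !twist_unit ?normrM ?norm_conjC ?g1 ?e1 ?mul1r //.
have -> : Lphase K (γ * ε^*) = (Lphase K ε)^† ∘ Lphase K γ.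
  by rewrite Lphase_dag LphaseM mulrC.
by rewrite dagM dagK !LcompA.
Qed.

(** On [prepend w x] the phase of w cancels, and what remains is conjugation by diag(1, e l) in the
    first factor, or by 1 if w is empty. *)
Lemma lift_right_phase e l (γ : C) (T : 'L(H l)) :
  phase_or_zero γ -> (forall l, `|e l| = 1) ->
  (Lwphase e)^† ∘ lift_right γ T ∘ Lwphase e = lift_right (γ * (e l)^*) T.
Proof.
move=> gP e1; apply: (@prepend_ext _ _ l) => x w wp.
rewrite (LconjE _ (lift_right γ T)) Lwphase_prepend //.
rewrite (LadjZ (lift_right γ T)) (LadjZ (Lwphase e)^†).
rewrite !lift_right_prepend // Lwphase_dag Lwphase_prepend // scalerA.
rewrite {2}/word_phase -tag_phase_conj tag_phase_unit // scale1r.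
have -> : (if nilp w then 1 else γ * (e l)^*) =
    (if nilp w then 1 else γ) * (if nilp w then 1 else e l)^*.
  by case: ifP => // _; rewrite rmorph1 mulr1.
rewrite -twist_phase; last by case: ifP; rewrite ?normr1.
  rewrite Lphase_dag !LcompE; congr (prepend w (Lphase _ _ _)).
  by case: ifP; rewrite ?rmorph1.
exact: phase_or_zero_if.
Qed.

Lemma Lrev_Lwphase e :
  Lwphase e ∘ Lrev H = Lrev H ∘ Lwphase (e \o negb).
Proof.
apply: Ladj_elem_ext => w wp; rewrite !LcompE Lrev_elem //.
rewrite !Lwphase_elem ?word_pred_rev // LadjZ Lrev_elem //.
congr (_ *: _); rewrite /word_phase map_rev tag_phase_rev //.
by case/and3P: wp.
Qed.

(* A left lift prepends to the reversed word, where the transition that it adds is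
   the opposite one. *)
Definition phase_shift e (s : direction) l : C :=
  if s is rightwards then e l else e (~~ l).

(** For a left lift, moving the diagonal unitary through R exchanges the two values of [e]. *)
Lemma lift_phase e s l (γ : C) (T : 'L(H l)) :
  phase_or_zero γ -> (forall l, `|e l| = 1) ->
  (Lwphase e)^† ∘ lift s γ T ∘ Lwphase e = lift s (γ * (phase_shift e s l)^*) T.
Proof.
case: s => gP e1; first exact: lift_right_phase.
have RW : Lrev H ∘ Lwphase e = Lwphase (e \o negb) ∘ Lrev H.
  rewrite -[in LHS](_ : e \o negb \o negb = e); last first.
    by apply/funext => b /=; rewrite negbK.
  by rewrite -Lrev_Lwphase.
rewrite /= /lift_left; apply: Ladj_ext => x.
pose X := (Lwphase (e \o negb))^† ∘ lift_right γ T ∘ Lwphase (e \o negb).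
have RWx y : Lrev H (Lwphase e y) = Lwphase (e \o negb) (Lrev H y).
  by rewrite -[LHS](LcompE (Lrev H)) RW.
have WRx y : (Lwphase e)^† ((Lrev H)^† y) =
    (Lrev H)^† ((Lwphase (e \o negb))^† y).
  by rewrite -[LHS](LcompE (Lwphase e)^†) -[RHS](LcompE (Lrev H)^†) -!dagM RW.
rewrite [LHS]LconjE [RHS]LconjE (LconjE _ (lift_right γ T)) RWx WRx; congr (_^† _).
by rewrite -(LconjE _ (lift_right γ T)) lift_right_phase // => b; exact: e1.
Qed.

End Phases.

(** * Equalities between the products *)

Section ProductIdentities.
Variable C : numClosedFieldType.

Definition flip (s : direction) := if s is rightwards then leftwards else rightwards.

Lemma lift_flip (H : bool -> preHilbertType C) s l (γ : C) (T : 'L(H l)) :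
  lift (flip s) γ T = (Lrev H)^† ∘ lift s γ T ∘ Lrev H.
Proof.
case: s => //=; rewrite /lift_left Lrev_dag; apply: Ladj_ext => x.
have RK y : Lrev H (Lrev H y) = y by rewrite -LcompE LrevK.
rewrite (LcompE (_ ∘ _)) (LcompE (Lrev H)) (LcompE (_ ∘ _)) (LcompE (Lrev H)).
by rewrite !RK.
Qed.

(** As T_0 = 0, the right lift kills [prepend w x] for nonempty w. It therefore kills words of two
    or more letters and has range in CΩ ⊕ H_l, which R fixes; R also fixes the words of at most one
    letter. *)
Lemma lift_zero (H : bool -> preHilbertType C) s s' l (T : 'L(H l)) :
  lift s 0 T = lift s' 0 T.
Proof.
suff E : lift_left 0 T = lift_right 0 T by case: s; case: s' => /=; rewrite ?E.
have lnil := word_nil_subproof H (Some l).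
have nilE (x : H l) : lift_right 0 T (prepend [::] x) = prepend [::] (T x).
  by rewrite lift_right_prepend ?twist1.
have consE (x : H l) a w : word_pred (Some l) (a :: w) ->
    lift_right 0 T (prepend (a :: w) x) = 0.
  by move=> wp; rewrite lift_right_prepend // twist0 [LHS]linear0.
have short w : word_pred None w -> (1 < size w)%N -> lift_right 0 T (elem None w) = 0.
  move=> wp; case: (word_splitP l wp) => [x v x0 vp|v vp].
    by rewrite -prepend_same //; case: v vp => [|a v] vp //= _; exact: consE.
  by rewrite -(prepend_other vp); case: v vp => [|a v] vp //= _; exact: consE.
have range w : word_pred None w ->
    exists z : H l, lift_right 0 T (elem None w) = prepend [::] z.
  move=> wp; case: (word_splitP l wp) => [x v x0 vp|v vp].
    rewrite -prepend_same //; case: v vp => [|a v] vp; first by exists (T x).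
    by exists 0; rewrite consE // [RHS]linear0.
  rewrite -(prepend_other vp); case: v vp => [|a v] vp; first by exists (T Ω).
  by exists 0; rewrite consE // [RHS]linear0.
have RE z : Lrev H (prepend [::] (z : H l)) = prepend [::] z.
  have zp : word_pred None [:: mkletter (center z)].
    by rewrite word_pred_cons center_vac eqxx.
  by rewrite prependE // Ladj_linear !Lrev_elem.
rewrite /lift_left; apply: Ladj_elem_ext => w wp.
rewrite (LconjE _ (lift_right 0 T)) Lrev_elem // Lrev_dag.
have wE : lift_right 0 T (elem None (rev w)) = lift_right 0 T (elem None w).
  case: w wp => [|a [|b w]] wp //.
  by rewrite !short // ?word_pred_rev // size_rev.
by rewrite wE; have [z ->] := range w wp.
Qed.

Lemma F_equiv s1 s2 (γ1 δ1 γ2 δ2 : C) s1' s2' γ1' δ1' γ2' δ2' :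
  (forall H : bool -> preHilbertType C, exists W : 'L(alt_space H None),
    [/\ W^† ∘ W = Lid _, W ∘ W^† = Lid _, W Ω = Ω &
      forall l (T : 'L(H l)),
        lift s1' (if l then δ1' else γ1') T =
          W^† ∘ lift s1 (if l then δ1 else γ1) T ∘ W /\
        lift s2' (if l then δ2' else γ2') T =
          W^† ∘ lift s2 (if l then δ2 else γ2) T ∘ W]) ->
  F s1 s2 γ1 δ1 γ2 δ2 = F s1' s2' γ1' δ1' γ2' δ2'.
Proof.
move=> eqv; apply: lift_product_eq => H; have [W [WV VW W1 WE]] := eqv H.
by exists W; split=> // -[] l T; have [] := WE l T.
Qed.

Lemma LconjId (K : preHilbertType C) (T : 'L(K)) : (Lid K)^† ∘ T ∘ Lid K = T.
Proof. by rewrite Lid_dag; exact: Ladj_ext. Qed.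

Lemma LidK (K : preHilbertType C) : (Lid K)^† ∘ Lid K = Lid K.
Proof. by rewrite Lid_dag; exact: Ladj_ext. Qed.

Lemma LidKr (K : preHilbertType C) : Lid K ∘ (Lid K)^† = Lid K.
Proof. by rewrite Lid_dag; exact: Ladj_ext. Qed.

Lemma F_flip s1 s2 (γ1 δ1 γ2 δ2 : C) :
  F s1 s2 γ1 δ1 γ2 δ2 = F (flip s1) (flip s2) γ1 δ1 γ2 δ2.
Proof.
apply: F_equiv => H; exists (Lrev H); split; rewrite ?Lrev_dag ?LrevK //.
  by rewrite -(elem_nil H None) Lrev_elem.
by move=> l T; rewrite !lift_flip Lrev_dag.
Qed.

Lemma F_zero1 s1 s1' s2 (γ2 δ2 : C) : F s1 s2 0 0 γ2 δ2 = F s1' s2 0 0 γ2 δ2.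
Proof.
apply: F_equiv => H; exists (Lid _); split; rewrite ?LidK ?LidKr //.
by move=> l T; rewrite !LconjId if_same (lift_zero s1' s1).
Qed.

Lemma F_zero2 s1 s2 s2' (γ1 δ1 : C) : F s1 s2 γ1 δ1 0 0 = F s1 s2' γ1 δ1 0 0.
Proof.
apply: F_equiv => H; exists (Lid _); split; rewrite ?LidK ?LidKr //.
by move=> l T; rewrite !LconjId if_same (lift_zero s2' s2).
Qed.

Lemma F_phase s1 s2 (γ1 δ1 γ2 δ2 ε η : C) :
  phase_or_zero γ1 -> phase_or_zero δ1 -> phase_or_zero γ2 -> phase_or_zero δ2 ->
  `|ε| = 1 -> `|η| = 1 ->
  let shift s l := (phase_shift (fun i => if i then η else ε) s l)^* in
  F s1 s2 γ1 δ1 γ2 δ2 =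
  F s1 s2 (γ1 * shift s1 false) (δ1 * shift s1 true)
          (γ2 * shift s2 false) (δ2 * shift s2 true).
Proof.
move=> g1 d1 g2 d2 e1 n1 shift; apply: F_equiv => H.
have u l : `|if l then η else ε| = 1 by case: l.
exists (Lwphase H (fun i => if i then η else ε)).
split; first exact: Lwphase_dagK.
- exact: Lwphase_Kdag.
- by rewrite -(elem_nil H None) Lwphase_elem // scale1r.
by case=> T; rewrite !lift_phase.
Qed.

End ProductIdentities.

(** * Moments that separate the listed products *)

Section TwoLetters.
Variables (C : numClosedFieldType) (H : bool -> preHilbertType C).
Implicit Types (s : direction) (l i j : bool).

(* The side of the first letter of the word produced by a lift on side l from a
   one-letter word of the other side. *)
Definition front s l := if s is rightwards then l else ~~ l.

(** The letter x added to the word y by a lift on side l: in front by a right lift, at the end by a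
    left lift. *)
Definition two_letters s l (x : H l) (y : H (~~ l)) : seq (letter H) :=
  if s is rightwards then [:: mkletter x; mkletter y]
  else [:: mkletter y; mkletter x].

Lemma word_pred_two s l (x : H l) (y : H (~~ l)) : ⟨Ω, x⟩ = 0 -> ⟨Ω, y⟩ = 0 ->
  word_pred None (two_letters s x y).
Proof.
move=> x0 y0; rewrite /word_pred /alternating /centered.
by case: s; rewrite /= x0 y0 eqxx !andbT; case: (l).
Qed.

(** The hypothesis makes [e l i] the same unit vector for both i, so only the order of the sides
    matters, and the first letter determines it. *)
Lemma word_fun_two s s' (e : forall l, bool -> H l) l l' i i' j j' :
  (forall l i j, ⟨e l i, e l j⟩ = 1) ->
  word_fun (two_letters s (e l i) (e (~~ l) j))
           (two_letters s' (e l' i') (e (~~ l') j')) =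
  (front s l == front s' l')%:R.
Proof.
move=> e1.
have fE k k' m m' : letter_fun (mkletter (e k m)) (mkletter (e k' m')) = (k == k')%:R.
  have [kk|kk] := eqVneq k k'; last by rewrite letter_fun_neq.
  by subst k'; rewrite letter_funE e1.
by case: s s' l l' => -[] [] []; rewrite /= !fE /= ?mulr1 ?mul1r ?mul0r.
Qed.

(** Only the block from CΩ to Ω^⊥, which carries γ, contributes. *)
Lemma twist_vac (K : preHilbertType C) (γ : C) (T : 'L(K)) :
  ⟨Ω, T Ω⟩ = 0 -> twist γ T Ω = γ *: T Ω.
Proof.
move=> T0; have PΩ : Lvac K Ω = Ω by exact: Lvac_vac.
have QΩ : Lvacp K Ω = 0 by rewrite -[LHS]/(Ω - Lvac K Ω) PΩ subrr.
have PT : Lvac K (T Ω) = 0 by rewrite LvacE T0 scale0r.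
have QT : Lvacp K (T Ω) = T Ω by rewrite -[LHS]/(T Ω - Lvac K (T Ω)) PT subr0.
rewrite /twist !LaddE !LscaleE.
rewrite !(LcompE (_ ∘ _)) !(LcompE _ T) PΩ QΩ PT QT !(linear0 T).
by rewrite (linear0 (Lvac K)) (linear0 (Lvacp K)) !scaler0 !addr0 add0r.
Qed.

Lemma lift_vac s l (γ : C) (T : 'L(H l)) : ⟨Ω, T Ω⟩ = 0 ->
  lift s γ T Ω = elem None [:: mkletter (T Ω)].
Proof.
move=> T0; have nilP := word_nil_subproof H (Some l).
have rightE : lift_right γ T Ω = elem None [:: mkletter (T Ω)].
  rewrite -[X in lift_right _ _ X](elem_nil H None) -(prepend_other nilP).
  by rewrite lift_right_prepend // [nilp _]/= twist1 prepend_same.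
case: s => //; rewrite -[LHS](LconjE _ (lift_right γ T)) LconjE.
have -> : Lrev H Ω = Ω by rewrite -(elem_nil H None) Lrev_elem.
by rewrite rightE Lrev_dag Lrev_elem // word_pred_cons T0 eqxx.
Qed.

(** The word y is [prepend] of Ω to a nonempty word, so T_γ acts on that Ω. *)
Lemma lift_letter s l (γ : C) (T : 'L(H l)) (y : H (~~ l)) :
  ⟨Ω, T Ω⟩ = 0 -> ⟨Ω, y⟩ = 0 ->
  lift s γ T (elem None [:: mkletter y]) = γ *: elem None (two_letters s (T Ω) y).
Proof.
move=> T0 y0.
have yP : word_pred (Some l) [:: mkletter y].
  by rewrite /word_pred /centered /= y0 eqxx; case: (l).
have rightE : lift_right γ T (elem None [:: mkletter y]) =
    γ *: elem None [:: mkletter (T Ω); mkletter y].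
  rewrite -(prepend_other yP) lift_right_prepend // [nilp _]/= twist_vac //.
  by rewrite prependZ prepend_same.
case: s => //; rewrite -[LHS](LconjE _ (lift_right γ T)) LconjE.
rewrite Lrev_elem ?(word_pred_None yP) // rightE LadjZ Lrev_dag Lrev_elem //.
exact: (word_pred_two rightwards T0 y0).
Qed.

End TwoLetters.

(** * Moments common to all models *)

Section MomentsOfModels.
Variable C : numClosedFieldType.
Variables (A : twoFaced C) (phi : A -> C) (a : forall i, face A i).
(** In every representation of [phi], the two elements [a i] map Ω to the same unit vector,
    orthogonal to Ω. *)
Hypotheses (phi0 : forall i, phi (face_incl (a i)) = 0)
  (phi1 : forall i j, phi (star (face_incl (a i)) ⋅ face_incl (a j)) = 1).

Definition gen (l i : bool) : A ⊔ A :=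
  if l then coprodr A (face_incl (a i)) else coprodl A (face_incl (a i)).

(** The inner product of two two-letter vectors. The generator applied to Ω is always taken from
    face [true]: there its lift acts as the untwisted operator, and only the outer generators bring
    in parameters. *)
Definition probe (l i l' i' : bool) : A ⊔ A :=
  star (gen l i ⋅ gen (~~ l) true) ⋅ (gen l' i' ⋅ gen (~~ l') true).

Lemma lift_models_probe s γ δ omega l i l' i' :
  lift_models s γ δ phi phi omega ->
  omega (probe l i l' i') = (gain γ δ i l)^* * gain γ δ i' l' *
    (front (s i) l == front (s i') l')%:R.
Proof.
case=> H [G [pi [sigma [Pi [[pih piE] [sigmah sigmaE] Pih PiE ->]]]]].
pose T k m : 'L(pair_family H G k) :=
  match k with
  | true => sigma (face_incl (a m))
  | false => pi (face_incl (a m))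
  end.
have T0 k m : ⟨Ω, T k m Ω⟩ = 0 by case: k; rewrite /T -?piE -?sigmaE phi0.
have T1 k m n : ⟨T k m Ω, T k n Ω⟩ = 1.
  rewrite -(phi1 m n); case: k; rewrite /T.
    by rewrite sigmaE; case: sigmah => _ -> ->; rewrite Lsmul LcompE dagPr.
  by rewrite piE; case: pih => _ -> ->; rewrite Lsmul LcompE dagPr.
have PigenE k m : Pi (gen k m) = lift (s m) (gain γ δ m k) (T k m).
  by case: k; case: (PiE m) => PiA PiB; rewrite /gen ?PiA ?PiB.
case: Pih => _ PiM PiS; rewrite /probe PiM PiS !PiM !Lsmul LcompE dagPr.
have gE k m : (Pi (gen k m) ∘ Pi (gen (~~ k) true)) Ω =
    gain γ δ m k *: elem None (two_letters (s m) (T k m Ω) (T (~~ k) true Ω)).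
  rewrite (LcompE (Pi (gen k m))) !PigenE lift_vac // lift_letter //.
rewrite !gE innerZl innerZr inner_elem ?word_pred_two // mulrA.
by rewrite (word_fun_two _ _ (e := fun k m => T k m Ω)).
Qed.

End MomentsOfModels.

(** * The space C^2 and the rank-one operator from Ω to [excited] *)

Section TwoDimensional.
Variable C : numClosedFieldType.

Definition bool_fun (x y : bool) : C := (x == y)%:R.

Fact bool_fun_herm x y : bool_fun y x = (bool_fun x y)^*.
Proof. by rewrite /bool_fun rmorph_nat eq_sym. Qed.

Fact bool_fun_psd : psd bool_fun.
Proof.
have rank1 (f : bool -> C) : psd (fun x y => (f x)^* * f y).
  move=> t; have := mul_conjC_ge0 (\sum_(p <- t) p.1 * f p.2).
  rewrite mulrC rmorph_sum mulr_suml; congr (0 <= _); apply: eq_bigr => p _ /=.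
  rewrite mulr_sumr; apply: eq_bigr => q _.
  by rewrite rmorphM /= mulrACA.
(* The identity matrix is the sum of two rank-one projections. *)
have -> : bool_fun = fun x y : bool => (x%:R)^* * y%:R + ((~~ x)%:R)^* * (~~ y)%:R.
  apply/funext => x; apply/funext => y; rewrite !rmorph_nat /bool_fun.
  by case: x y => -[]; rewrite /= ?(mulr0, mul0r, mulr1, addr0, add0r).
by apply: psd_add; [exact: (rank1 (fun x => x%:R))|exact: (rank1 (fun x => (~~ x)%:R))].
Qed.

Definition bool_kernel : kernel C bool :=
  @Kernel C bool bool_fun bool_fun_herm bool_fun_psd false erefl.

Definition qubit := kspace bool_kernel.
HB.instance Definition _ := PreHilbert.on qubit.

Definition excited : qubit := kgen bool_kernel true.

Lemma inner_vac_excited : ⟨Ω, excited⟩ = 0.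
Proof. by rewrite inner_genl. Qed.

Lemma inner_excited : ⟨excited, excited⟩ = 1.
Proof. by rewrite inner_genl. Qed.

Fact raising_subproof (x y : qubit) :
  ⟨⟨excited, x⟩ *: (Ω : qubit), y⟩ = ⟨x, ⟨Ω, y⟩ *: excited⟩.
Proof. by rewrite innerZl innerZr -inner_conj mulrC. Qed.

Definition raising : 'L(qubit) := @mkL C qubit qubit
  (fun y => ⟨Ω, y⟩ *: excited) (fun x => ⟨excited, x⟩ *: Ω) raising_subproof.

Lemma raising_vac : raising Ω = excited.
Proof. by rewrite -[LHS]/(⟨Ω, Ω⟩ *: excited) inner_vac scale1r. Qed.

End TwoDimensional.

Section VectorStates.
Variable C : numClosedFieldType.

Lemma coprod_rec (A B D : starAlgType C) (f : A -> D) (g : B -> D) :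
  star_hom f -> star_hom g -> exists h : A ⊔ B -> D,
  [/\ star_hom h, h \o @coprodl C A B =1 f & h \o @coprodr C A B =1 g].
Proof. by move=> fh gh; case: (coprodP A B) => _ _ /(_ D f g fh gh)[h []]; exists h. Qed.

(** The extended functional takes x^* x to the squared norm of x.1 Ω + π(x.2) Ω. *)
Lemma vector_state (A : starAlgType C) (H : preHilbertType C) (pi : A -> 'L(H)) :
  star_hom pi -> state (fun a => ⟨Ω, pi a Ω⟩).
Proof.
move=> [pil piM piS]; split=> [c a b|x].
  by rewrite pil LaddE LscaleE innerDr innerZr.
have -> : unital_ext (fun a => ⟨Ω, pi a Ω⟩) (star x ⋅ x) = x.1^* * x.1 +
  ⟨Ω, pi (x.1^* *: x.2 + x.1 *: star x.2 + star x.2 ⋅ x.2) Ω⟩ by [].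
have := inner_ge0 (x.1 *: Ω + pi x.2 Ω); congr (0 <= _).
have piD y z : pi (y + z) = pi y + pi z by have := pil 1 y z; rewrite !scale1r.
have piZ k y : pi (k *: y) = k *: pi y.
  exact: (star_homZ (And3 pil piM piS)).
rewrite !piD !piZ !LaddE !LscaleE piM !piS Lsmul LcompE !innerDr !innerZr.
rewrite !dagPr !innerDl !innerZl inner_vac mulr1 mulrDr -!addrA.
by rewrite (mulrC x.1); congr (_ + _); rewrite addrCA.
Qed.

End VectorStates.

(** * The separating state on L(C^2) ⊔ L(C^2) *)

Section Separation.
Variable C : numClosedFieldType.

Local Notation Lqubit := ('L(qubit C) : starAlgType C).

Definition qubit_incl (i : bool) : Lqubit -> Lqubit ⊔ Lqubit :=
  if i then @coprodr C Lqubit Lqubit else @coprodl C Lqubit Lqubit.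

Fact id_star_hom (A : starAlgType C) : star_hom (id : A -> A). Proof. by []. Qed.

Fact qubit_incl_inj i : injective (@qubit_incl i).
Proof.
(* The codiagonal map is a left inverse of both inclusions. *)
have [h [_ hl hr]] := coprod_rec (id_star_hom Lqubit) (id_star_hom Lqubit).
by apply: (can_inj (g := h)) => x; case: i; [exact: hr|exact: hl].
Qed.

Definition qubit_algebra : twoFaced C :=
  @TwoFaced C (Lqubit ⊔ Lqubit) (fun=> Lqubit) qubit_incl qubit_incl_inj
    (coprodP Lqubit Lqubit).

Lemma probe_exists : exists (A : twoFaced C) (phi : A -> C)
    (c : bool -> bool -> bool -> bool -> A ⊔ A),
  state phi /\ forall (s : bool -> direction) (γ δ : bool -> C) l i l' i',
    (forall k m, phase_or_zero (gain γ δ k m)) ->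
    lift_product s γ δ phi phi (c l i l' i') =
    (gain γ δ i l)^* * gain γ δ i' l' * (front (s i) l == front (s i') l')%:R.
Proof.
(* The codiagonal represents both faces on the same C^2, so both copies of [raising] send Ω to
   [excited]. *)
have [pi [pih pil pir]] := coprod_rec (id_star_hom Lqubit) (id_star_hom Lqubit).
pose A := qubit_algebra.
pose a (i : bool) : face A i := raising C.
pose phi (x : A) : C := ⟨Ω, pi x Ω⟩.
have piE i (T : Lqubit) : pi (qubit_incl i T) = T.
  by case: i; [exact: pir|exact: pil].
exists A, phi, (probe a); split; first exact: vector_state.
move=> s γ δ l i l' i' gP.
(* A model must exist for [xget] to choose one instead of its default. *)
have [omega omegaP] : exists omega, lift_models s γ δ phi phi omega.
  have lh k m := lift_star_hom (pair_family (qubit C) (qubit C)) (s k) m (gP k m).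
  (* [f] collects the λ-lifts of the two faces, and [g] the ρ-lifts. *)
  have [f [fh fl fr]] := coprod_rec (lh false false) (lh true false).
  have [g [gh gl gr]] := coprod_rec (lh false true) (lh true true).
  have [Pi [Pih Pil Pir]] := coprod_rec fh gh.
  exists (fun c => ⟨Ω, Pi c Ω⟩), (qubit C), (qubit C), pi, pi, Pi; split=> //.
  move=> k; split=> b.
    rewrite -[LHS]/((Pi \o @coprodl C A A) (qubit_incl k b)) Pil /= piE.
    by case: k b => b; [exact: fr|exact: fl].
  rewrite -[LHS]/((Pi \o @coprodr C A A) (qubit_incl k b)) Pir /= piE.
  by case: k b => b; [exact: gr|exact: gl].
have -> : lift_product s γ δ phi phi =
  xget (fun=> 0) (lift_models s γ δ phi phi) by [].
apply: (@lift_models_probe C A phi a).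
- by move=> k; rewrite /phi piE raising_vac inner_vac_excited.
- move=> k m; rewrite /phi; case: (pih) => _ -> ->.
  by rewrite !piE Lsmul LcompE dagPr !raising_vac inner_excited.
- by apply: xgetPex; exists omega.
Qed.

End Separation.

(** * Classification *)

Section Classification.
Variable C : numClosedFieldType.
Implicit Types (s : direction) (γ δ ζ θ : C).

Lemma admissible_phase_or_zero γ δ : admissible γ δ ->
  phase_or_zero γ /\ phase_or_zero δ.
Proof. by case=> -[g d]; split; [right|right|left|left]. Qed.

Lemma conj_mul_unit γ : `|γ| = 1 -> γ^* * γ = 1.
Proof. by rewrite mulrC; exact: unit_conj. Qed.

(** The choice ε = γ2, η = δ2 brings the second face to (1, 1). *)
Lemma F_same_side γ1 δ1 γ2 δ2 :
  `|γ1| = 1 -> `|δ1| = 1 -> `|γ2| = 1 -> `|δ2| = 1 ->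
  F rightwards rightwards γ1 δ1 γ2 δ2 =
  F rightwards rightwards (γ1 * γ2^*) (δ1 * δ2^*) 1 1.
Proof.
move=> g1 d1 g2 d2.
by rewrite (@F_phase C _ _ _ _ _ _ γ2 δ2) /= ?unit_conj //; right.
Qed.

(** The second face, lifted on the left, is multiplied by η^* and ε^* in this order, so ε = δ2 and η
    = γ2 bring it to (1, 1). *)
Lemma F_opposite_sides γ1 δ1 γ2 δ2 :
  `|γ1| = 1 -> `|δ1| = 1 -> `|γ2| = 1 -> `|δ2| = 1 ->
  F rightwards leftwards γ1 δ1 γ2 δ2 =
  F rightwards leftwards (γ1 * δ2^*) (δ1 * γ2^*) 1 1.
Proof.
move=> g1 d1 g2 d2.
by rewrite (@F_phase C _ _ _ _ _ _ δ2 γ2) /= ?unit_conj //; right.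
Qed.

Lemma F_free_boolean s1 s2 γ δ : `|γ| = 1 -> `|δ| = 1 ->
  F s1 s2 γ δ 0 0 = F rightwards rightwards 1 1 0 0.
Proof.
move=> g1 d1.
(* Flipping both faces if necessary makes the first a right lift; the direction of the zero face can
   then be changed. *)
have -> : F s1 s2 γ δ 0 0 = F rightwards rightwards γ δ 0 0.
  by case: s1; [|rewrite F_flip]; exact: F_zero2.
rewrite (@F_phase C _ _ _ _ _ _ γ δ) /= ?unit_conj ?mul0r //;
  by [right|left].
Qed.

Lemma F_boolean_free s1 s2 γ δ : `|γ| = 1 -> `|δ| = 1 ->
  F s1 s2 0 0 γ δ = F rightwards rightwards 0 0 1 1.
Proof.
move=> g1 d1.
have -> : F s1 s2 0 0 γ δ = F rightwards rightwards 0 0 γ δ.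
  by case: s2; [|rewrite F_flip]; exact: F_zero1.
rewrite (@F_phase C _ _ _ _ _ _ γ δ) /= ?unit_conj ?mul0r //;
  by [right|left].
Qed.

Lemma F_listed s1 s2 γ1 δ1 γ2 δ2 : admissible γ1 δ1 -> admissible γ2 δ2 ->
  exists2 e : listed C, listed_valid e & F s1 s2 γ1 δ1 γ2 δ2 = listed_product e.
Proof.
case=> [[g1 d1]|[-> ->]]; case=> [[g2 d2]|[-> ->]].
- wlog s1r : s1 s2 / s1 = rightwards.
    by case: s1 => rightP; [exact: rightP|rewrite F_flip; exact: rightP].
  rewrite {}s1r; case: s2.
    exists (SameSide (γ1 * γ2^*) (δ1 * δ2^*)); last exact: F_same_side.
    by rewrite /= !normrM !norm_conjC g1 d1 g2 d2 mulr1.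
  exists (OppositeSides (γ1 * δ2^*) (δ1 * γ2^*)); last exact: F_opposite_sides.
  by rewrite /= !normrM !norm_conjC g1 d1 g2 d2 mulr1.
- by exists (FreeBoolean C) => //; exact: F_free_boolean.
- by exists (BooleanFree C) => //; exact: F_boolean_free.
- exists (BooleanBoolean C) => //.
  by rewrite (F_zero1 s1 rightwards) (F_zero2 _ s2 rightwards).
Qed.

(* The values of γ1 γ2^*, δ1 δ2^* (both 0 if s1 <> s2), γ1 δ2^*, δ1 γ2^* (both 0
   if s1 = s2), |γ1|^2 and |γ2|^2. *)
Definition signature (e : listed C) : seq C :=
  match e with
  | SameSide ζ θ => [:: ζ; θ; 0; 0; 1; 1]
  | OppositeSides ζ θ => [:: 0; 0; ζ; θ; 1; 1]
  | FreeBoolean => [:: 0; 0; 0; 0; 1; 0]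
  | BooleanFree => [:: 0; 0; 0; 0; 0; 1]
  | BooleanBoolean => [:: 0; 0; 0; 0; 0; 0]
  end.

(** The positions of the nonzero entries determine the constructor, since ζ and θ have modulus 1. *)
Lemma signature_inj e e' : listed_valid e -> listed_valid e' ->
  signature e = signature e' -> e = e'.
Proof.
have nz ζ : `|ζ| = 1 -> ζ <> 0.
  by move=> z1 z0; move: z1; rewrite z0 normr0 => /esym/eqP; rewrite oner_eq0.
have n10 : (1 : C) <> 0 by apply/eqP; rewrite oner_eq0.
case: e e' => [ζ θ|ζ θ|||] [ζ' θ'|ζ' θ'|||] //= ev e'v; case=> *; subst=> //;
  by exfalso; first [exact: n10 | exact: nesym n10 | case: ev => /nz].
Qed.

Lemma signature_moments : exists (A : twoFaced C) (phi : A -> C) (cs : seq (A ⊔ A)),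
  state phi /\ forall e, listed_valid e ->
    [seq listed_product e phi phi c | c <- cs] = signature e.
Proof.
have [A [phi [c [phi_state cE]]]] := probe_exists C.
(* In the first four moments the conjugated factor comes from the second face, which is (1, 1)
   whenever ζ and θ occur, so they return ζ and θ unconjugated. *)
exists A, phi, [:: c false true false false; c true true true false;
  c true true false false; c false true true false;
  c false false false false; c false true false true]; split=> //.
have FE s1 s2 γ1 δ1 γ2 δ2 l i l' i' : admissible γ1 δ1 -> admissible γ2 δ2 ->
    F s1 s2 γ1 δ1 γ2 δ2 phi phi (c l i l' i') =
    (gain (fun i => if i then γ2 else γ1) (fun i => if i then δ2 else δ1) i l)^* *
    gain (fun i => if i then γ2 else γ1) (fun i => if i then δ2 else δ1) i' l' *
    (front (if i then s2 else s1) l == front (if i' then s2 else s1) l')%:R.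
  move=> /admissible_phase_or_zero[g1 d1] /admissible_phase_or_zero[g2 d2].
  by apply: cE => -[] [].
have one : admissible (1 : C) 1 by left; rewrite normr1.
have zero : admissible (0 : C) 0 by right.
case=> [ζ θ [z1 t1]|ζ θ [z1 t1]|_|_|_] /=;
  try (have zt : admissible ζ θ by left); rewrite !FE // /gain /=;
  try rewrite (conj_mul_unit z1);
  by rewrite ?(conjC0, conjC1, mulr0, mul0r, mulr1, mul1r).
Qed.

Lemma listed_coincide_eq (e e' : listed C) : listed_valid e -> listed_valid e' ->
  coincide (listed_product e) (listed_product e') -> e = e'.
Proof.
move=> ev e'v co; apply: signature_inj => //.
have [A [phi [cs [phi_state csE]]]] := signature_moments.
by rewrite -!csE //; apply: eq_map => c; exact: co.
Qed.

End Classification.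
Theorem theorem6p17 (R : realType) :
  [/\ forall ζ θ : R[i], `|ζ| = 1 -> `|θ| = 1 ->
        coincide (F rightwards rightwards ζ θ 1 1) (F leftwards leftwards ζ θ 1 1),
      forall ζ θ : R[i], `|ζ| = 1 -> `|θ| = 1 ->
        coincide (F rightwards leftwards ζ θ 1 1) (F leftwards rightwards ζ θ 1 1),
      forall s1 s2 : direction,
        coincide (F rightwards rightwards (1 : R[i]) 1 0 0) (F s1 s2 1 1 0 0),
      forall s1 s2 : direction,
        coincide (F rightwards rightwards (0 : R[i]) 0 1 1) (F s1 s2 0 0 1 1) &
      forall (s1 s2 : direction) (γ1 δ1 γ2 δ2 : R[i]),
        admissible γ1 δ1 -> admissible γ2 δ2 ->
        exists! e : listed R[i],
          listed_valid e /\ coincide (F s1 s2 γ1 δ1 γ2 δ2) (listed_product e)].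
Proof.
split=> [ζ θ _ _|ζ θ _ _|s1 s2|s1 s2|s1 s2 γ1 δ1 γ2 δ2 adm1 adm2].
- by rewrite F_flip.
- by rewrite F_flip.
- by rewrite (F_free_boolean s1 s2) ?normr1.
- by rewrite (F_boolean_free s1 s2) ?normr1.
(* The product equals a listed one, so uniqueness reduces to separating the listed products. *)
have [e ev ->] := F_listed s1 s2 adm1 adm2.
by exists e; split=> [//|e' [e'v co]]; exact: listed_coincide_eq.
Qed.
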